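(* Let $(a_\ell)_{\ell\in\mathbb N_0}$ be a decreasing convex null sequence of positive real numbers such that, for every $p>1$, the sequence $(a_\ell^p/a_{\ell+1})_{\ell\in\mathbb N_0}$ is bounded. Then $K=\{0\}\cup\{a_\ell:\ell\in\mathbb N_0\}$ has the smooth extension property.
   Context: A sequence $(a_\ell)_{\ell\in\mathbb N_0}$ is convex if the sequence of differences $a_\ell-a_{\ell+1}$ is decreasing, equivalently $a_\ell\le (a_{\ell-1}+a_{\ell+1})/2$ for all $\ell\ge1$. A null sequence is a sequence converging to $0$. For compact $K\subseteq\mathbb R$ let $C^\infty(K)=\{F|_K: F\in C^\infty(\mathbb R)\}$, endowed with the quotient topology of the Fréchet space $C^\infty(\mathbb R)$ (smooth functions with uniform convergence of all derivatives on compact sets) under the restriction map $F\mapsto F|_K$. $K$ has the smooth extension property if there is a continuous linear operator $E:C^\infty(K)\to C^\infty(\mathbb R)$ with $E(f)|_K=f$ for all $f\in C^\infty(K)$. *)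

(* Defs.v *)
From HB Require Import structures.
From mathcomp Require Import all_boot all_order all_algebra.
From mathcomp Require Import all_classical all_reals all_analysis.

Set Implicit Arguments.
Unset Strict Implicit.
Unset Printing Implicit Defensive.

Import Order.TTheory GRing.Theory Num.Theory numFieldNormedType.Exports.

Local Open Scope classical_set_scope.
Local Open Scope ring_scope.

Definition convex_seq (R : realType) (a : R^nat) : Prop :=
  nonincreasing_seq (fun l => a l - a l.+1).

Definition smooth (R : realType) : set (R -> R) :=
  [set F | forall n x, derivable (derive1n n F) x 1].

Section smooth_theory.
Variable R : realType.
Implicit Types F G : R -> R.

Lemma derive1n_lin (c : R) F G n : smooth F -> smooth G ->
  derive1n n (c *: F + G) = c *: derive1n n F + derive1n n G.
Proof.
move=> sF sG; elim: n => [|n IHn]; first by rewrite !derive1n0.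
rewrite !derive1nS IHn; apply/funext => x.
by rewrite !fctE !derive1E deriveD ?deriveZ//; exact: derivableZ.
Qed.

Lemma derive1n_cst0 n : derive1n n (0 : R -> R) = 0.
Proof.
elim: n => [|n IHn]; first by rewrite derive1n0.
by rewrite derive1nS IHn; apply/funext => x; rewrite derive1_cst.
Qed.

Lemma smooth0 : smooth (0 : R -> R).
Proof. by move=> n x; rewrite derive1n_cst0. Qed.

Lemma smooth_lin (c : R) F G : smooth F -> smooth G -> smooth (c *: F + G).
Proof.
move=> sF sG n x; rewrite derive1n_lin//.
by apply: derivableD => //; exact: derivableZ.
Qed.

End smooth_theory.

Definition smooth_pred (R : realType) : {pred (R -> R)} := mem (@smooth R).

Lemma smooth_submod (R : realType) : submod_closed (@smooth_pred R).
Proof.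
split; first by rewrite inE; exact: smooth0.
by move=> c F G; rewrite !inE; exact: smooth_lin.
Qed.

HB.instance Definition _ (R : realType) :=
  GRing.isSubmodClosed.Build R (R -> R) (@smooth_pred R) (@smooth_submod R).

Record Cinfty (R : realType) := MkCinfty {
  Cinfty_fun :> R -> R;
  Cinfty_smooth : Cinfty_fun \in @smooth_pred R
}.

HB.instance Definition _ (R : realType) := [isSub for @Cinfty_fun R].
HB.instance Definition _ (R : realType) := [Choice of Cinfty R by <:].
HB.instance Definition _ (R : realType) :=
  [SubChoice_isSubLmodule of Cinfty R by <:].

Definition derivatives (R : realType) (F : Cinfty R) :
    prod_topology (fun _ : nat => {family compact, R -> R}) :=
  fun n => derive1n n F.

(** The Fréchet topology: the coarsest one making every [derive1n n]
    continuous for uniform convergence on compact sets. *)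
HB.instance Definition _ (R : realType) :=
  Uniform.copy (Cinfty R) (initial_topology (@derivatives R)).

Definition smooth_on (R : realType) (K : set R) : set (K -> R) :=
  [set f | exists2 F : R -> R, smooth F & f = F \o \val].

Definition smooth_on_pred (R : realType) (K : set R) : {pred (K -> R)} :=
  mem (@smooth_on R K).

Lemma smooth_on_submod (R : realType) (K : set R) :
  submod_closed (@smooth_on_pred R K).
Proof.
split; first by rewrite inE; exists 0 => //; exact: smooth0.
move=> c f g; rewrite !inE => -[F sF ->] [G sG ->].
by exists (c *: F + G) => //; exact: smooth_lin.
Qed.

HB.instance Definition _ (R : realType) (K : set R) :=
  GRing.isSubmodClosed.Build R (K -> R) (@smooth_on_pred R K)
    (@smooth_on_submod R K).

Record Cinfty_on (R : realType) (K : set R) := MkCinfty_on {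
  Cinfty_on_fun :> K -> R;
  Cinfty_on_smooth : Cinfty_on_fun \in @smooth_on_pred R K
}.

HB.instance Definition _ (R : realType) (K : set R) :=
  [isSub for @Cinfty_on_fun R K].
HB.instance Definition _ (R : realType) (K : set R) :=
  [Choice of Cinfty_on K by <:].
HB.instance Definition _ (R : realType) (K : set R) :=
  [SubChoice_isSubLmodule of Cinfty_on K by <:].

Lemma restr_subproof (R : realType) (K : set R) (F : Cinfty R) :
  (Cinfty_fun F \o \val : K -> R) \in @smooth_on_pred R K.
Proof.
by rewrite inE; exists F => //; have := Cinfty_smooth F; rewrite inE.
Qed.

Definition restr (R : realType) (K : set R) (F : Cinfty R) : Cinfty_on K :=
  MkCinfty_on (restr_subproof K F).

Section quotient_topology.
Variables (R : realType) (K : set R).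

(** [Cinfty_on K] carries the final topology for [restr K], not the topology
    of compact convergence inherited from [K -> R]. *)
Definition Cinfty_on_open (U : set (Cinfty_on K)) : Prop :=
  open (@restr R K @^-1` U).

Let openT_on : Cinfty_on_open setT.
Proof. by rewrite /Cinfty_on_open preimage_setT; exact: openT. Qed.

Let openI_on : setI_closed Cinfty_on_open.
Proof. by move=> U V; exact: openI. Qed.

Let open_bigcup_on (I : Type) (f : I -> set (Cinfty_on K)) :
  (forall i, Cinfty_on_open (f i)) -> Cinfty_on_open (\bigcup_i f i).
Proof. by move=> of_; apply: bigcup_open => i _; exact: of_. Qed.

HB.instance Definition _ :=
  isOpenTopological.Build (Cinfty_on K) openT_on openI_on open_bigcup_on.

End quotient_topology.

Definition smooth_extension_property (R : realType) (K : set R) : Prop :=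
  exists E : {linear Cinfty_on K -> Cinfty R},
    continuous E /\ forall f : Cinfty_on K, restr K (E f) = f.

(* Main.v *)
(** Let K = {0} ∪ {a_l}, d_l = a_l - a_(l+1) and s(x) = inf_l max(|x - a_l|, d_l), a Lipschitz
    function that vanishes only at 0.  Cut the line off 0 into pieces of length comparable to
    s, with a subordinate partition of unity phi_i, and on the i-th piece replace F by its
    Lagrange interpolant P_i F at n_i + 1 points of K near the piece, one of which is the
    point of K in the piece, if there is one.  The resulting function depends only on F|K
    and agrees with F on K.

    Since the gaps decrease, K contains n + 1 points at distance O(s) whose mutual distances
    are at least of the order s: they can be chosen equidistant, unless a_l < 6 (n + 1) s, in
    which case a_(l+1) >= c a_l^p for all p > 1 gives points with mutual distances at least
    of the order s^(1 + 1/(n + 1)).  The derivatives of the Lagrange basis polynomials are then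
    O(s^(-k - 1)), with a constant depending on n which is at most 1/s if n tends to infinity
    slowly enough.  Comparing with the Taylor polynomial of degree m - 1 one gets
    |(P_i F - F)^(k)| <= C s^(m - k - 2) sup |F^(m)| as soon as n_i + 1 >= m.  With m = k + 3,
    the k-th derivatives of phi_i (P_i F - F) are bounded by C s_i, which is summable because
    the s_i are comparable to the lengths of the pieces.  So the extension operator loses
    three derivatives, and the extension is smooth at 0 as well. *)

From HB Require Import structures.
Require Import Defs.
From mathcomp Require Import all_boot all_order all_algebra.
From mathcomp Require Import all_classical all_reals all_analysis.
From mathcomp Require Import ring lra.
Import Order.TTheory GRing.Theory Num.Theory numFieldNormedType.Exports.
Local Open Scope classical_set_scope.
Local Open Scope ring_scope.

Set Implicit Arguments.
Unset Strict Implicit.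
Unset Printing Implicit Defensive.

(** * Calculus of smooth functions of one variable *)

Section smooth_closure.
Variable R : realType.
Implicit Types (f g u F : R -> R) (x c : R).

(** Coinduction: a class of differentiable functions stable under [derive1] has only smooth members,
    so no formula for higher derivatives is needed. *)
Lemma smooth_coind (S : set (R -> R)) :
    (forall f, S f -> (forall x, derivable f x 1) /\ S (derive1 f)) ->
  S `<=` @smooth R.
Proof.
move=> SP f Sf n; have : S (derive1n n f).
  elim: n => [|n IH]; first by rewrite derive1n0.
  by rewrite derive1nS; exact: (SP _ IH).2.
by move=> /SP[].
Qed.

Lemma smooth_derivable f x : smooth f -> derivable f x 1.
Proof. by move=> /(_ 0%N x); rewrite derive1n0. Qed.

Lemma smooth_derive1n n f : smooth f -> smooth (derive1n n f).
Proof. by move=> sf m x; rewrite /derive1n -iterD; exact: sf. Qed.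

Lemma smooth_derive1 f : smooth f -> smooth (derive1 f).
Proof. by move=> sf; rewrite -(derive1n1 f); exact: smooth_derive1n. Qed.

(** Products or compositions alone are not stable under derivation; the closure under all three
    operations is, so [smooth_coind] applies to it. *)
Inductive smooth_alg : (R -> R) -> Prop :=
| SmoothBase f : smooth f -> smooth_alg f
| SmoothAdd f g : smooth_alg f -> smooth_alg g -> smooth_alg (f + g)
| SmoothMul f g : smooth_alg f -> smooth_alg g -> smooth_alg (f * g)
| SmoothComp f g : smooth_alg f -> smooth_alg g -> smooth_alg (f \o g).

Lemma derive1D f g : (forall x, derivable f x 1) -> (forall x, derivable g x 1) ->
  derive1 (f + g) = derive1 f + derive1 g.
Proof. by move=> df dg; apply/funext => x; rewrite derive1E deriveD// -!derive1E. Qed.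

Lemma derive1M f g : (forall x, derivable f x 1) -> (forall x, derivable g x 1) ->
  derive1 (f * g) = derive1 f * g + f * derive1 g.
Proof.
move=> df dg; apply/funext => x.
rewrite derive1E deriveM// -!derive1E !fctE /GRing.scale/=; ring.
Qed.

Lemma smooth_alg_smooth : smooth_alg `<=` @smooth R.
Proof.
apply: smooth_coind => f; elim=> {f}.
- move=> f sf; split; first by move=> x; exact: smooth_derivable.
  exact/SmoothBase/smooth_derive1.
- move=> f g sf [df sf'] sg [dg sg']; split; first by move=> x; exact: derivableD.
  by rewrite derive1D//; exact: SmoothAdd.
- move=> f g sf [df sf'] sg [dg sg']; split; first by move=> x; exact: derivableM.
  by rewrite derive1M//; apply: SmoothAdd; exact: SmoothMul.
- move=> f g sf [df sf'] sg [dg sg']; split.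
    move=> x; apply/derivable1_diffP; apply: differentiable_comp.
      exact/derivable1_diffP.
    exact/derivable1_diffP.
  have -> : derive1 (f \o g) = (derive1 f \o g) * derive1 g.
    by apply/funext => x; rewrite derive1_comp.
  by apply: SmoothMul => //; exact: SmoothComp.
Qed.

Lemma smoothD f g : smooth f -> smooth g -> smooth (f + g).
Proof. by move=> sf sg; apply: smooth_alg_smooth; apply: SmoothAdd; apply: SmoothBase. Qed.

Lemma smoothM f g : smooth f -> smooth g -> smooth (f * g).
Proof. by move=> sf sg; apply: smooth_alg_smooth; apply: SmoothMul; apply: SmoothBase. Qed.

Lemma smooth_comp f g : smooth f -> smooth g -> smooth (f \o g).
Proof. by move=> sf sg; apply: smooth_alg_smooth; apply: SmoothComp; apply: SmoothBase. Qed.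

Lemma smooth_horner (p : {poly R}) : smooth (horner p).
Proof.
have : [set horner q | q in [set: {poly R}]] (horner p) by exists p.
apply: smooth_coind => _ [q _ <-]; split; first exact: derivable_horner.
by rewrite -derivE; exists q^`().
Qed.

Lemma derive1n_horner n (p : {poly R}) : derive1n n (horner p) = horner (p^`(n)).
Proof.
by elim: n p => [|n IH] p; rewrite ?derive1n0 ?derivn0// derive1Sn -derivE IH -derivSn.
Qed.

Lemma smooth_cst c : smooth (cst c).
Proof. by rewrite -hornerC_ext; exact: smooth_horner. Qed.

Lemma smoothB f g : smooth f -> smooth g -> smooth (f - g).
Proof.
move=> sf sg; have -> : f - g = (-1) *: g + f by rewrite scaleN1r addrC.
exact: smooth_lin.
Qed.

Lemma derive1nD n f g : smooth f -> smooth g ->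
  derive1n n (f + g) = derive1n n f + derive1n n g.
Proof. by move=> sf sg; have := derive1n_lin 1 n sf sg; rewrite !scale1r. Qed.

Lemma derive1nB n f g : smooth f -> smooth g ->
  derive1n n (f - g) = derive1n n f - derive1n n g.
Proof.
move=> sf sg; have -> : f - g = (-1) *: g + f by rewrite scaleN1r addrC.
by rewrite derive1n_lin// scaleN1r addrC.
Qed.

Lemma smooth_continuous n f : smooth f -> continuous (derive1n n f).
Proof.
move=> sf x; apply: differentiable_continuous; apply/derivable1_diffP; exact: sf.
Qed.

Lemma smooth_bounded_on n f (r : R) : smooth f ->
  exists M, forall x, `|x| <= r -> `|derive1n n f x| <= M.
Proof.
move=> sf; have [r0|r0] := ltP r 0.
  by exists 0 => x xr; have := le_lt_trans xr r0; rewrite ltNge normr_ge0.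
have cf : {within `[(- r)%R, r], continuous (fun x => `|derive1n n f x|)}.
  apply: continuous_subspaceT => x.
  by apply: continuous_comp; [exact: smooth_continuous|exact: norm_continuous].
have [c _ Hc] := EVT_max (ge0_cp r0).2 cf.
exists `|derive1n n f c| => x xr; apply: Hc.
by rewrite in_itv/= -ler_norml.
Qed.

Lemma derive1n_near0 n f (U : set R) x : open U -> U x ->
  (forall y, U y -> f y = 0) -> derive1n n f x = 0.
Proof.
move=> oU Ux Uf; elim: n x Ux => [|n IH] x Ux; first by rewrite derive1n0 Uf.
rewrite derive1nS derive1E (@near_eq_derive _ _ _ _ (cst 0)); first by rewrite derive_cst.
by near=> y; apply: IH; near: y; exact: open_nbhs_nbhs.
Unshelve. all: by end_near. Qed.

Lemma derive1n_affine n f (c d : R) : smooth f ->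
  derive1n n (fun x => f (c * x + d)) = fun x => c ^+ n * derive1n n f (c * x + d).
Proof.
move=> sf; elim: n => [|n IH].
  by apply/funext => x; rewrite !derive1n0 expr0 mul1r.
have hE : (fun x => c * x + d) = horner (c *: 'X + d%:P).
  by apply/funext => x; rewrite !hornerE.
have dh x : derivable (fun x => c * x + d) x 1 by rewrite hE; exact: derivable_horner.
have dh' x : derive1 (fun x => c * x + d) x = c.
  by rewrite hE -derivE derivD derivC derivZ derivX !hornerE.
rewrite derive1nS IH; apply/funext => x.
rewrite derive1E (_ : (fun _ => _) = c ^+ n *: (derive1n n f \o (fun x => c * x + d)))//.
have dc : derivable (derive1n n f \o (fun x => c * x + d)) x 1.
  apply/derivable1_diffP; apply: differentiable_comp; first exact/derivable1_diffP.
  exact/derivable1_diffP/sf.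
rewrite deriveZ; last exact: dc.
rewrite -derive1E derive1_comp; [|exact: dh|exact: sf].
by rewrite dh' derive1nS /GRing.scale/= exprSr mulrA mulrAC.
Qed.

Lemma smooth_affine f (c d : R) : smooth f -> smooth (fun x => f (c * x + d)).
Proof.
move=> sf; rewrite (_ : (fun _ => _) = f \o horner (c *: 'X + d%:P)); last first.
  by apply/funext => x /=; rewrite !hornerE.
apply: smooth_comp => //; exact: smooth_horner.
Qed.

(* The bound [2^k A B r^k] is stable under the product rule, so that no binomial sum is
   needed. *)
Lemma derive1nM_le (k : nat) f g x (A B r : R) : 0 <= r ->
    smooth f -> smooth g ->
    (forall j, (j <= k)%N -> `|derive1n j f x| <= A * r ^+ j) ->
    (forall j, (j <= k)%N -> `|derive1n j g x| <= B * r ^+ j) ->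
  `|derive1n k (f * g) x| <= 2 ^+ k * A * B * r ^+ k.
Proof.
move=> r0; elim: k f g A B => [|k IH] f g A B sf sg hf hg.
  have := hf 0%N isT; have := hg 0%N isT.
  rewrite !derive1n0 !expr0 !mulr1 mul1r normrM => h1 h2.
  by apply: ler_pM.
rewrite derive1Sn derive1M//; try by move=> y; exact: smooth_derivable.
have sf' := smooth_derive1 sf; have sg' := smooth_derive1 sg.
rewrite derive1nD; [|exact: smoothM..].
rewrite fctE (le_trans (ler_normD _ _))//.
have h1 : `|derive1n k (derive1 f * g) x| <= 2 ^+ k * (A * r) * B * r ^+ k.
  apply: IH => // j jk; last by apply: hg; rewrite ltnW.
  by rewrite -derive1Sn -mulrA -exprS; exact: hf.
have h2 : `|derive1n k (f * derive1 g) x| <= 2 ^+ k * A * (B * r) * r ^+ k.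
  apply: IH => // j jk; first by apply: hf; rewrite ltnW.
  by rewrite -derive1Sn -mulrA -exprS; exact: hg.
apply: (le_trans (lerD h1 h2)); rewrite le_eqVlt; apply/orP; left; apply/eqP.
rewrite !exprS; ring.
Qed.

(** The first condition on [z] serves remainder estimates; the second keeps [z] in a ball about 0
    where the derivatives are bounded. *)
Lemma mvt_le f (B x y : R) : (forall z, derivable f z 1) ->
  (forall z, `|z - x| <= `|y - x| -> `|z| <= Num.max `|x| `|y| ->
    `|derive1 f z| <= B) ->
  `|f y - f x| <= B * `|y - x|.
Proof.
move=> df Hb.
have cf (u v : R) : {within `[u, v], continuous f}.
  apply: continuous_subspaceT => z.
  exact/differentiable_continuous/derivable1_diffP.
have isd (z : R) : is_derive z 1 f (derive1 f z).
  by rewrite derive1E; exact: derivableP.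
have seg (z u v : R) : u <= z <= v -> `|z| <= Num.max `|u| `|v|.
  move=> /andP[uz zv]; rewrite le_max; have [z0|z0] := leP 0 z.
    by rewrite (ger0_norm z0) (le_trans zv (ler_norm _)) orbT.
  by rewrite (ltr0_norm z0) -(normrN u) (le_trans _ (ler_norm _))// lerN2.
have [xy|yx] := leP x y.
  have [z zxy ->] := MVT_segment xy (fun z _ => isd z) (cf x y).
  rewrite normrM ler_wpM2r//; move: zxy; rewrite in_itv/= => zxy.
  apply: Hb; last exact: seg.
  move: zxy => /andP[xz zy].
  by rewrite !ger0_norm ?subr_ge0// lerB.
have [z zxy E] := MVT_segment (ltW yx) (fun z _ => isd z) (cf y x).
rewrite distrC E normrM (distrC x y) ler_wpM2r//.
move: zxy; rewrite in_itv/= => zxy.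
apply: Hb; last by rewrite maxC; exact: seg.
move: zxy => /andP[yz zx].
by rewrite distrC (distrC y) !ger0_norm ?subr_ge0// ?(ltW yx)// lerB.
Qed.

(** Induction on [m], applied to [derive1 f]; only [j = 0] needs the mean value inequality. *)
Lemma taylor_le m f (c r M : R) : smooth f -> `|c| <= r ->
    (forall j, (j < m)%N -> derive1n j f c = 0) ->
    (forall x, `|x| <= r -> `|derive1n m f x| <= M) ->
  forall j x, (j <= m)%N -> `|x| <= r ->
    `|derive1n j f x| <= M * `|x - c| ^+ (m - j).
Proof.
move=> + cr; elim: m f => [|m IH] f sf f0 fM j x.
  by rewrite leqn0 => /eqP -> xr; rewrite subnn expr0 mulr1; exact: fM.
have H i y : (i <= m)%N -> `|y| <= r ->
    `|derive1n i (derive1 f) y| <= M * `|y - c| ^+ (m - i).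
  apply: (IH _ (smooth_derive1 sf)) => [k km|z zr]; first by rewrite -derive1Sn; exact: f0.
  by rewrite -derive1Sn; exact: fM.
case: j => [_ xr|j]; last by rewrite ltnS subSS derive1Sn; exact: H.
rewrite derive1n0 subn0 exprSr mulrA.
have := f0 0%N isT; rewrite derive1n0 => fc0.
rewrite -[f x]subr0 -fc0; apply: mvt_le => [z|z zx zr].
  exact: smooth_derivable.
have zr' : `|z| <= r by rewrite (le_trans zr)// ge_max cr.
have := H 0%N z isT zr'; rewrite derive1n0 subn0 => /le_trans; apply.
have M0 : 0 <= M := le_trans (normr_ge0 _) (fM _ cr).
by rewrite ler_wpM2l// lerXn2r// nnegrE.
Qed.

Lemma taylor1_le f (B x y : R) : smooth f ->
  (forall z, `|derive1n 2 f z| <= B) ->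
  `|f y - f x - derive1 f x * (y - x)| <= B * (y - x) ^+ 2.
Proof.
move=> sf fB; pose g := f - horner (derive1 f x *: 'X).
have sg : smooth g by apply: smoothB => //; exact: smooth_horner.
have -> : f y - f x - derive1 f x * (y - x) = g y - g x.
  by rewrite /g !fctE !hornerZ !hornerX; ring.
rewrite -(real_normK (num_real (y - x))) expr2 mulrA.
apply: mvt_le => [z|z zx _]; first exact: smooth_derivable.
have -> : derive1 g z = derive1 f z - derive1 f x.
  rewrite -(derive1n1 g) derive1nB//; last exact: smooth_horner.
  rewrite derive1n_horner derivn1 derivZ derivX alg_polyC derive1n1.
  by rewrite -[LHS]/(derive1 f z - (derive1 f x)%:P.[z]) hornerC.
apply: (@le_trans _ _ (B * `|z - x|)); last first.
  by rewrite ler_wpM2l// (le_trans _ (fB 0)).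
apply: mvt_le => [t|t _ _]; first exact/smooth_derivable/smooth_derive1.
by rewrite -derive1n1 -derive1Sn; exact: fB.
Qed.

End smooth_closure.

(** * A smooth step function *)

Section flat_step.
Variable R : realType.
Implicit Types (f g u F : R -> R) (x c : R).

(** The difference quotient is off by at most C |h|. The criterion serves both for [flat] at 0 and
    for series, where it avoids any interchange of limits. *)
Lemma is_derive_quadratic f x (d C : R) :
    (forall y, `|f y - f x - d * (y - x)| <= C * (y - x) ^+ 2) ->
  is_derive x 1 f d.
Proof.
move=> fC.
have H : h^-1 *: ((f \o shift x) (h *: 1) - f x) @[h --> 0^'] --> d.
  apply/cvgrPdist_le => e e0; near=> h.
  have h0 : h != 0 by near: h; exact: nbhs_dnbhs_neq.
  have he : `|h| <= e / (`|C| + 1).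
    near: h; apply: dnbhs0_le; rewrite divr_gt0// ltr_wpDl//.
  rewrite /GRing.scale/= mulr1 distrC.
  have -> : h^-1 * (f (h + x) - f x) - d = h^-1 * (f (h + x) - f x - d * ((h + x) - x)).
    by field.
  rewrite normrM normfV mulrC ler_pdivrMr ?normr_gt0//.
  apply: (le_trans (fC _)); rewrite addrK -(real_normK (num_real h)).
  have C0 : 0 < `|C| + 1 by rewrite ltr_wpDl.
  move: he; rewrite ler_pdivlMr// => he.
  apply: (@le_trans _ _ ((`|C| + 1) * `|h| ^+ 2)).
    by rewrite ler_wpM2r ?exprn_ge0// (le_trans (ler_norm _))// lerDl.
  by rewrite expr2 mulrA ler_wpM2r// mulrC.
by apply: DeriveDef; [apply/cvg_ex; exists d|exact/cvg_lim].
Unshelve. all: by end_near. Qed.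

(** The polynomial factor makes the family stable under derivation: P turns into (P - P') X^2. *)
Definition flat (P : {poly R}) : R -> R :=
  fun x => if 0 < x then P.[x^-1] * expR (- x^-1) else 0.

(** The exponential series gives y^i <= i! e^y for each monomial. *)
Lemma horner_expRN_bounded (P : {poly R}) :
  exists C, forall y : R, 0 < y -> `|P.[y] * expR (- y)| <= C.
Proof.
exists (\sum_(i < size P) `|P`_i| * i`!%:R) => y y0.
rewrite horner_coef mulr_suml (le_trans (ler_norm_sum _ _ _))//.
apply: ler_sum => i _; rewrite -mulrA normrM ler_wpM2l//.
rewrite expRN ger0_norm; last by rewrite divr_ge0 ?expR_ge0// exprn_ge0 ?ltW.
rewrite ler_pdivrMr ?expR_gt0//; case: (nat_of_ord i) => [|n].
  by rewrite expr0 fact0 mul1r -expR0 ler_expR ltW.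
rewrite mulrC -ler_pdivrMr ?ltr0n ?fact_gt0//.
by apply: le_trans (expR_ge1Dxn n (ltW y0)); rewrite lerDr.
Qed.

Lemma is_derive_flat (P : {poly R}) x :
  is_derive x 1 (flat P) (flat ((P - P^`()) * 'X^2) x).
Proof.
have [x0|x0|->] := ltgtP x 0.
- apply: (@near_eq_is_derive _ _ _ (cst 0)).
    near=> y; rewrite /flat ifF//=; apply/negbTE; rewrite -leNgt ltW//.
    by near: y; exact: lt_nbhsl.
  by rewrite /flat ltNge (ltW x0)/=; exact: is_derive_cst.
- pose E y := P.[y] * expR (- y).
  apply: (@near_eq_is_derive _ _ _ (E \o (fun y => y^-1))).
    near=> y; rewrite /flat ifT//=.
    by near: y; exact: lt_nbhsr.
  rewrite /flat x0.
  have dE : is_derive x^-1 1 E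
      (P.[x^-1] * (expR (- x^-1) * -1) + expR (- x^-1) * (P^`()).[x^-1]).
    rewrite (_ : E = horner P * (expR \o -%R))//.
    apply: is_deriveM; apply: is_derive1_comp.
  have dV : is_derive x 1 (fun y : R => y^-1) (- x ^- 2 * 1).
    by apply: is_deriveV; rewrite gt_eqF.
  apply: (is_derive_eq (is_derive1_comp dE dV)).
  rewrite !(hornerXn, hornerM, hornerD, hornerN) -exprVn.
  by apply: (_ : _ = _ :> R); ring.
rewrite {2}/flat ltxx.
(* For y > 0 the remainder at 0 is y^2 (P X^2)(1/y) e^(-1/y), and the product of the last two
   factors is bounded. *)
have [C HC] := horner_expRN_bounded (P * 'X^2).
apply: (@is_derive_quadratic _ _ _ C) => y.
rewrite /flat ltxx !subr0 mul0r subr0.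
have := HC 1 ltr01; move=> /(le_trans (normr_ge0 _)) C0.
case: ifPn => y0; last by rewrite normr0 mulr_ge0// sqr_ge0.
have y2 : 0 < y ^+ 2 by rewrite exprn_gt0.
rewrite -ler_pdivrMr// -(ger0_norm (ltW y2)) -normfV -normrM.
apply: le_trans (HC y^-1 _); last by rewrite invr_gt0.
by rewrite hornerM hornerXn exprVn mulrAC.
Unshelve. all: by end_near. Qed.

Lemma smooth_flat P : smooth (flat P).
Proof.
have : [set flat Q | Q in [set: {poly R}]] (flat P) by exists P.
apply: smooth_coind => _ [Q _ <-]; split.
  by move=> x; have [] := is_derive_flat Q x.
exists ((Q - Q^`()) * 'X^2) => //; apply/funext => x.
by rewrite derive1E; have [_ ->] := is_derive_flat Q x.
Qed.

(* With [e = flat 1], the step is [1 - e (e 1 - e x) / e (e 1)]: it is constant where [e x]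
   is [0] or at least [e 1]. *)
Lemma smooth_step : exists th : R -> R,
  [/\ smooth th, (forall x, x <= 0 -> th x = 0), (forall x, 1 <= x -> th x = 1) &
      forall k, exists C, forall x, `|derive1n k th x| <= C].
Proof.
pose e := flat 1.
have se : smooth e by exact: smooth_flat.
have e0 x : x <= 0 -> e x = 0 by move=> x0; rewrite /e /flat ltNge x0.
have e1 : 0 < e 1 by rewrite /e /flat ltr01 hornerE mul1r expR_gt0.
have ee1 : 0 < e (e 1) by rewrite {1}/e /flat e1 hornerE mul1r expR_gt0.
have e1x x : 1 <= x -> e 1 <= e x.
  move=> x1; rewrite /e /flat ltr01 (lt_le_trans ltr01 x1) !hornerE ler_expR lerN2 invr1.
  by rewrite invf_le1// (lt_le_trans ltr01).
pose th := cst 1 - (e (e 1))^-1 *: (e \o (cst (e 1) - e)).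
have sth : smooth th.
  apply: smoothB; first exact: smooth_cst.
  rewrite -[X in smooth X]addr0; apply: smooth_lin; last exact: smooth0.
  by apply: smooth_comp; [exact: se|apply: smoothB; [exact: smooth_cst|exact: se]].
have th0 x : x <= 0 -> th x = 0.
  move=> x0; have -> : th x = 1 - (e (e 1))^-1 * e (e 1 - e x) by [].
  by rewrite (e0 x)// subr0 mulVf ?subrr// gt_eqF.
have th1 x : 1 <= x -> th x = 1.
  move=> x1; have e10 : e (e 1 - e x) = 0 by apply: e0; rewrite subr_le0 e1x.
  by rewrite /th !fctE/= e10 scaler0 subr0.
(* [th] is constant on either side of [0, 1], so compactness bounds its derivatives; order 0 is
   apart because the value on the right is 1. *)
exists th; split=> // -[|k].
  have [M HM] := smooth_bounded_on 0 1 sth.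
  exists (Num.max M 1) => x; rewrite le_max.
  have [x0|x0] := leP x 0; first by rewrite derive1n0 th0// normr0 ler01 orbT.
  have [x1|x1] := leP 1 x; first by rewrite derive1n0 th1// normr1 lexx orbT.
  by rewrite HM// ger0_norm ltW.
have [M HM] := smooth_bounded_on k.+1 1 sth.
exists (Num.max M 0) => x; rewrite le_max.
have [x0|x0] := ltP x 0.
  rewrite (@derive1n_near0 _ _ _ [set x | x < 0])//; first by rewrite normr0 lexx orbT.
  by move=> y /ltW; exact: th0.
have [x1|x1] := ltP 1 x.
  rewrite (_ : derive1n k.+1 th x = 0) ?normr0 ?lexx ?orbT//.
  have : derive1n k.+1 (th - cst 1) x = 0.
    apply: (@derive1n_near0 _ _ _ [set x | 1 < x]) => // y /ltW y1.
    by rewrite !fctE th1// subrr.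
  rewrite derive1nB//; last exact: smooth_cst.
  rewrite -hornerC_ext derive1n_horner derivnC/=.
  by rewrite -[LHS]/(derive1n k.+1 th x - (0 : {poly R}).[x]) horner0 subr0.
by rewrite HM// ger0_norm.
Qed.

End flat_step.

(** * Term-by-term differentiation *)

Section dominated_series.
Variables (R : realType) (s : R^nat) (S : R).
Hypothesis s_ge0 : forall i, 0 <= s i.
Hypothesis s_sum : forall n, \sum_(0 <= i < n) s i <= S.

Lemma is_cvg_dominated (v : R^nat) (C : R) : (forall i, `|v i| <= C * s i) ->
  cvgn (series v).
Proof.
move=> vC; apply: normed_cvg.
have C0 i : 0 <= C * s i := le_trans (normr_ge0 _) (vC i).
apply: (series_le_cvg _ C0 vC) => //.
apply: is_cvg_seriesZ; apply: nondecreasing_is_cvgn.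
  by apply: nondecreasing_series => n _ _.
by exists S => _ [n _ <-]; rewrite /series/=.
Qed.

Lemma lim_dominated (v : R^nat) (C : R) : 0 <= C -> (forall i, `|v i| <= C * s i) ->
  `|limn (series v)| <= C * S.
Proof.
move=> C0 vC; have cv := is_cvg_dominated vC.
rewrite -lim_norm//; apply: limr_le; first exact: is_cvg_norm.
near=> n; rewrite /series/= (le_trans (ler_norm_sum _ _ _))//.
apply: (@le_trans _ _ (\sum_(0 <= i < n) C * s i)); first exact: ler_sum.
by rewrite -mulr_sumr ler_wpM2l.
Unshelve. all: by end_near. Qed.

Definition fun_series (u : nat -> R -> R) : R -> R :=
  fun x => limn (series (u ^~ x)).

(** One summable [s] dominates the terms in every order, up to a constant; the class is thus stable
    under termwise derivation, as [smooth_coind] needs. *)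
Definition dominated (u : nat -> R -> R) := (forall i, smooth (u i)) /\
  forall k, exists2 C, 0 <= C & forall i x, `|derive1n k (u i) x| <= C * s i.

(** The Taylor remainders of the terms are at most C2 s_i (y - x)^2 and sum to a quadratic bound. *)
Lemma is_derive_fun_series (u : nat -> R -> R) (x : R) : dominated u ->
  is_derive x 1 (fun_series u) (fun_series (fun i => derive1 (u i)) x).
Proof.
move=> [su du]; have [C2 C20 H2] := du 2%N.
apply: (@is_derive_quadratic _ _ _ _ (C2 * S)) => y.
have cvu z : cvgn (series (u ^~ z)).
  by have [C _ HC] := du 0%N; apply: (@is_cvg_dominated _ C) => i; exact: HC.
have cvu' z : cvgn (series (fun i => derive1 (u i) z)).
  have [C _ HC] := du 1%N; apply: (@is_cvg_dominated _ C) => i.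
  by rewrite -derive1n1; exact: HC.
pose w := (u ^~ y - u ^~ x) - (y - x) *: (fun i => derive1 (u i) x) : R^nat.
have -> : fun_series u y - fun_series u x -
    fun_series (fun i => derive1 (u i)) x * (y - x) = limn (series w).
  rewrite lim_seriesB; [|exact: is_cvg_seriesB|exact: is_cvg_seriesZ].
  by rewrite lim_seriesB// lim_seriesZ// mulrC.
rewrite -mulrA (mulrC S) mulrA.
apply: lim_dominated => [|i]; first by rewrite mulr_ge0// sqr_ge0.
rewrite mulrAC; have := @taylor1_le _ (u i) (C2 * s i) x y (su i) (H2 i).
by rewrite /w !fctE mulrC.
Qed.

Lemma dominated_derive1 u : dominated u -> dominated (fun i => derive1 (u i)).
Proof.
move=> [su du]; split=> [i|k]; first exact: smooth_derive1.
by have [C C0 HC] := du k.+1; exists C => // i x; rewrite -derive1Sn.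
Qed.

Lemma derive1_fun_series u : dominated u ->
  derive1 (fun_series u) = fun_series (fun i => derive1 (u i)).
Proof.
move=> du; apply/funext => x; rewrite derive1E.
by have [_ ->] := is_derive_fun_series x du.
Qed.

Lemma smooth_fun_series u : dominated u -> smooth (fun_series u).
Proof.
move=> du; have : [set fun_series v | v in dominated] (fun_series u) by exists u.
apply: smooth_coind => _ [v dv <-]; split.
  by move=> x; have [] := is_derive_fun_series x dv.
by rewrite derive1_fun_series//; exists (fun i => derive1 (v i)) => //; exact: dominated_derive1.
Qed.

Lemma derive1n_fun_series k u : dominated u ->
  derive1n k (fun_series u) = fun_series (fun i => derive1n k (u i)).
Proof.
elim: k u => [|k IH] u du.
  by rewrite derive1n0; congr fun_series; apply/funext => i; rewrite derive1n0.
rewrite derive1Sn derive1_fun_series// IH; last exact: dominated_derive1.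
by congr fun_series; apply/funext => i; rewrite derive1Sn.
Qed.

Lemma derive1n_fun_series_le k u (C : R) x : dominated u -> 0 <= C ->
  (forall i x, `|derive1n k (u i) x| <= C * s i) ->
  `|derive1n k (fun_series u) x| <= C * S.
Proof.
by move=> du C0 HC; rewrite derive1n_fun_series//; apply: lim_dominated.
Qed.

Lemma is_cvg_fun_series u x : dominated u -> cvgn (series (u ^~ x)).
Proof.
move=> [su du]; have [C _ HC] := du 0%N.
by apply: (@is_cvg_dominated _ C) => i; exact: HC.
Qed.

End dominated_series.

(** * Lagrange interpolation *)

Section interpolation.
Variable R : realType.
Implicit Types (b : seq R) (F : R -> R) (p : {poly R}).

Definition lagr b (y : R) : {poly R} :=
  \prod_(z <- b | z != y) ((y - z)^-1 *: ('X - z%:P)).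

Definition interp b F : {poly R} := \sum_(y <- b) F y *: lagr b y.

Lemma lagr_self b y : (lagr b y).[y] = 1.
Proof.
rewrite /lagr horner_prod big1// => z zy.
by rewrite hornerZ hornerXsubC mulVf// subr_eq0 eq_sym.
Qed.

Lemma lagr_other b y z : z \in b -> z != y -> (lagr b y).[z] = 0.
Proof.
move=> zb zy; rewrite /lagr horner_prod (big_rem z)//= zy.
by rewrite hornerZ hornerXsubC subrr mulr0 mul0r.
Qed.

Lemma interp_node b F y : uniq b -> y \in b -> (interp b F).[y] = F y.
Proof.
move=> ub yb; rewrite /interp horner_sum (bigD1_seq y)//= hornerZ lagr_self mulr1.
rewrite big_seq_cond big1 ?addr0// => z /andP[zb zy].
by rewrite hornerZ lagr_other ?mulr0// eq_sym.
Qed.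

Lemma size_lagr b y : uniq b -> y \in b -> (size (lagr b y) <= size b)%N.
Proof.
move=> ub yb.
have H (r : seq R) : (size (\prod_(z <- r | z != y) ((y - z)^-1 *: ('X - z%:P)))%R
    <= (count (predC1 y) r).+1)%N.
  elim: r => [|z r IH]; first by rewrite big_nil size_poly1.
  rewrite big_cons /=; case: ifP => // _.
  rewrite add1n (leq_trans (size_polyMleq _ _))//.
  have := size_scale_leq (y - z)^-1 ('X - z%:P); rewrite size_XsubC.
  by move=> h; rewrite -subn1 leq_subLR (leq_trans (leq_add h IH)).
apply: (leq_trans (H b)); rewrite -(count_predC (pred1 y) b).
by rewrite -add1n leq_add2r -has_count has_pred1.
Qed.

Lemma interp_horner b p : uniq b -> (size p <= size b)%N -> interp b (horner p) = p.
Proof.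
move=> ub pb; apply/eqP; rewrite -subr_eq0; apply/eqP.
apply: (@roots_geq_poly_eq0 _ _ b) => //.
  by apply/allP => y yb; rewrite rootE hornerD hornerN interp_node// subrr.
rewrite (leq_trans (size_polyD _ _))// geq_max size_polyN pb andbT.
rewrite /interp big_seq; apply: (big_ind (fun q : {poly R} => size q <= size b)%N).
- by rewrite size_poly0.
- by move=> q q' hq hq'; rewrite (leq_trans (size_polyD _ _))// geq_max hq.
- by move=> y yb; rewrite (leq_trans (size_scale_leq _ _))// size_lagr.
Qed.

Lemma interp_sub b F G : interp b (F - G) = interp b F - interp b G.
Proof. by rewrite /interp -sumrB; apply: eq_bigr => y _; rewrite scalerBl. Qed.

Lemma interp_lin b (c : R) F G : interp b (c *: F + G) = c *: interp b F + interp b G.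
Proof.
rewrite /interp scaler_sumr -big_split/=; apply: eq_bigr => y _.
by rewrite scalerA -scalerDl.
Qed.

Lemma derivn_linearM k (c z : R) p :
  (c *: ('X - z%:P) * p)^`(k.+1) =
  c *: ('X - z%:P) * p^`(k.+1) + (c *: p^`(k)) *+ k.+1.
Proof.
have dq : (c *: ('X - z%:P))^`() = c%:P by rewrite derivZ derivXsubC alg_polyC.
elim: k => [|k IH].
  by rewrite derivn1 derivn0 derivM dq mul_polyC derivn1 mulr1n addrC.
rewrite derivnS IH derivD derivM dq mul_polyC derivMn derivZ -!derivnS.
by rewrite addrC addrA -mulrSr addrC.
Qed.

(** Induction on the nodes. A factor is at most L / eta at [x] and has slope at most 1 / eta, so the
    two terms of [derivn_linearM] have the same bound, whence the 2. The node [y] brings no factor,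
    which is harmless since 1 <= L / eta. *)
Lemma lagr_le b (y x L eta : R) k : 0 < eta -> eta <= L ->
    {in b, forall z, z != y -> eta <= `|y - z|} ->
    {in b, forall z, `|x - z| <= L} ->
  `|(lagr b y)^`(k).[x]| <= (2 * L / eta) ^+ size b * k`!%:R / L ^+ k.
Proof.
move=> eta0 etaL sep near; have L0 : 0 < L := lt_le_trans eta0 etaL.
have B1 : 1 <= L / eta by rewrite ler_pdivlMr// mul1r.
have B0 : 0 <= L / eta by rewrite (le_trans _ B1).
rewrite /lagr -mulrA; elim: b sep near k => [|z b IH] sep near k.
  rewrite big_nil mul1r; case: k => [|k].
    by rewrite derivn0 hornerC normr1 fact0 expr0 divr1.
  by rewrite derivnC/= horner0 normr0 divr_ge0// exprn_ge0 ?ltW.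
have {}IH := IH (sub_in1 (@mem_behead _ (z :: b)) sep)
  (sub_in1 (@mem_behead _ (z :: b)) near).
rewrite big_cons /=; set q := \prod_(_ <- _ | _) _ in IH *.
set Q := 2 * L / eta in IH *; set N := size b in IH *.
have Qd : Q = 2 * (L / eta) by rewrite mulrA.
have Q0 : 0 <= Q by rewrite Qd mulr_ge0.
have grow j : `|q^`(j).[x]| * (L / eta) <= Q ^+ N * (L / eta) * (j`!%:R / L ^+ j).
  by rewrite mulrAC ler_wpM2r.
case: ifPn => zy; last first.
  rewrite (le_trans (IH k))// exprSr -mulrA ler_wpM2l ?exprn_ge0//.
  rewrite ler_peMl ?divr_ge0 ?exprn_ge0 ?(ltW L0)// Qd.
  by rewrite (le_trans B1)// ler_peMl// ler1n.
have hz : `|(y - z)^-1| <= eta^-1.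
  by rewrite normfV lef_pV2 ?posrE ?(lt_le_trans eta0)// sep// mem_head.
have hx : `|((y - z)^-1 *: ('X - z%:P)).[x]| <= L / eta.
  rewrite hornerZ hornerXsubC normrM mulrC ler_pM//.
  by rewrite near// mem_head.
rewrite exprSr -!mulrA.
case: k => [|k].
  rewrite derivn0 hornerM normrM mulrC.
  have := grow 0%N; rewrite derivn0 => g0.
  apply: (@le_trans _ _ (`|q.[x]| * (L / eta))); first by rewrite ler_wpM2l.
  apply: (le_trans g0); rewrite -!mulrA ler_wpM2l ?exprn_ge0//.
  by rewrite ler_peMl ?ler1n// mulrA mulr_ge0// fact0 expr0 divr1.
rewrite derivn_linearM hornerD hornerM hornerMn (hornerZ _ q^`(k)).
apply: (le_trans (ler_normD _ _)); rewrite normrMn !normrM.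
have h1 : `|((y - z)^-1 *: ('X - z%:P)).[x]| * `|q^`(k.+1).[x]| <=
    Q ^+ N * (L / eta) * (k.+1`!%:R / L ^+ k.+1).
  by apply: le_trans (grow k.+1); rewrite mulrC ler_wpM2l.
have h2 : (`|(y - z)^-1| * `|q^`(k).[x]|) *+ k.+1 <=
    Q ^+ N * (L / eta) * (k.+1`!%:R / L ^+ k.+1).
  have -> : Q ^+ N * (L / eta) * (k.+1`!%:R / L ^+ k.+1) =
      (eta^-1 * (Q ^+ N * (k`!%:R / L ^+ k))) *+ k.+1.
    rewrite factS natrM exprS -[RHS]mulr_natr; field.
    by rewrite expf_neq0 ?gt_eqF.
  by rewrite ler_wMn2r// ler_pM.
apply: (le_trans (lerD h1 h2)); rewrite Qd le_eqVlt; apply/orP; left; apply/eqP.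
by field; rewrite expf_neq0 ?gt_eqF.
Qed.

Lemma taylor_poly m (c : R) (v : R^nat) : exists2 T : {poly R},
  (size T <= m)%N & forall j, (j < m)%N -> (T^`(j)).[c] = v j.
Proof.
pose q : {poly R} := \poly_(j < m) (v j / j`!%:R).
exists (q \Po ('X - c%:P)).
  by rewrite size_comp_poly2 ?size_XsubC// size_poly.
move=> j jm; have -> : (q \Po ('X - c%:P))^`(j) = q^`(j) \Po ('X - c%:P).
  elim: j {jm} => [|j IH]; first by rewrite !derivn0.
  by rewrite !derivnS IH deriv_comp derivXsubC mulr1.
rewrite horner_comp hornerXsubC subrr horner_coef0 coef_derivn addn0 ffactnn.
by rewrite coef_poly jm -[LHS]mulr_natr divfK// pnatr_eq0 -lt0n fact_gt0.
Qed.

(** Interpolation reproduces the Taylor polynomial T of degree < m at [c], so F may be replaced by G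
    = F - T, which is at most M |y - c|^m. The nodes contribute A^m <= A^(size b), absorbed by the
    hypothesis on the basis; G itself contributes s^(m - k), weakened using s <= 1. *)
Lemma interp_error b F (c s r A M : R) m : uniq b -> smooth F -> (m <= size b)%N ->
    `|c| <= r -> 0 < s -> s <= 1 -> 1 <= A ->
    {in b, forall y, `|y - c| <= A * s} -> {in b, forall y, `|y| <= r} ->
    (forall k x, `|x - c| <= s / 4 ->
      A ^+ size b * \sum_(y <- b) `|(lagr b y)^`(k).[x]| <= k`!%:R / s ^+ k.+2) ->
    (forall x, `|x| <= r -> `|derive1n m F x| <= M) ->
  forall k x, (k <= m)%N -> `|x - c| <= s / 4 -> `|x| <= r ->
    `|derive1n k (horner (interp b F) - F) x| <= M * (k`!%:R + 1) * s ^+ m / s ^+ k.+2.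
Proof.
move=> ub sF mb cr s0 s1 A1 nearb br lag FM k x km xc xr.
have [T sT Tc] := taylor_poly m c (fun j => derive1n j F c).
pose G := F - horner T.
have sG : smooth G by apply: smoothB => //; exact: smooth_horner.
have dG j z : derive1n j G z = derive1n j F z - (T^`(j)).[z].
  by rewrite derive1nB//; [rewrite derive1n_horner|exact: smooth_horner].
have Gc j : (j < m)%N -> derive1n j G c = 0 by move=> jm; rewrite dG Tc ?subrr.
have GM z : `|z| <= r -> `|derive1n m G z| <= M.
  by move=> zr; rewrite dG derivn_poly0// horner0 subr0 FM.
have taylor := taylor_le sG cr Gc GM.
have M0 : 0 <= M := le_trans (normr_ge0 _) (FM _ cr).
have A0 : 0 <= A by rewrite (le_trans _ A1).
have -> : horner (interp b F) - F = horner (interp b G) - G.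
  rewrite interp_sub (interp_horner ub (leq_trans sT mb)).
  by apply/funext => z; rewrite /G !fctE hornerD hornerN opprB addrA subrK.
rewrite derive1nB//; last exact: smooth_horner.
rewrite derive1n_horner; apply: (le_trans (ler_normB _ _)).
rewrite mulrDr mulr1 !mulrDl; apply: lerD.
  rewrite /interp raddf_sum /= horner_sum (le_trans (ler_norm_sum _ _ _))//.
  apply: (@le_trans _ _ (\sum_(y <- b)
      M * s ^+ m * (A ^+ size b * `|(lagr b y)^`(k).[x]|))).
    rewrite !big_seq; apply: ler_sum => y yb.
    rewrite derivnZ hornerZ normrM mulrA ler_wpM2r//.
    have := taylor 0%N y isT (br y yb); rewrite derive1n0 subn0 => /le_trans; apply.
    rewrite -mulrA ler_wpM2l//.
    apply: (@le_trans _ _ ((A * s) ^+ m)).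
      apply: lerXn2r; rewrite ?nnegrE ?mulr_ge0 ?(ltW s0)//; exact: nearb.
    by rewrite exprMn mulrC ler_wpM2l ?exprn_ge0 ?(ltW s0)//; apply: ler_weXn2l.
  rewrite -mulr_sumr -mulr_sumr.
  have h : M * s ^+ m * (A ^+ size b * \sum_(y <- b) `|(lagr b y)^`(k).[x]|) <=
      M * s ^+ m * (k`!%:R / s ^+ k.+2).
    by rewrite ler_wpM2l ?lag// mulr_ge0// exprn_ge0// ltW.
  apply: (le_trans h); rewrite le_eqVlt; apply/orP; left; apply/eqP; ring.
apply: (le_trans (taylor k x km xr)).
rewrite -mulrA ler_wpM2l//.
apply: (@le_trans _ _ (s ^+ (m - k))).
  apply: lerXn2r; rewrite ?nnegrE ?(ltW s0)//; apply: (le_trans xc); lra.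
rewrite ler_pdivlMr ?exprn_gt0// -exprD; apply: ler_wiXn2l; rewrite ?(ltW s0)//.
by rewrite !addnS subnK// (leq_trans (leqnSn _)).
Qed.

End interpolation.

(** * Admissible interpolation nodes *)

Section nodes.
Variables (R : realType) (K : set R) (sc : R -> R).

(** The last clause makes every point of [K] in the piece a node, so that the interpolant takes the
    right value there. *)
Definition anchored (x : R) (b : seq R) := [/\ uniq b, {in b, forall y, K y} &
  forall y, K y -> `|y - x| <= sc x / 4 -> y \in b].

(* The nodes lie within [A s] of [x], and interpolation there loses only a factor [s^-2],
   even after multiplication by [A ^ size b]: a function that is [O(|y - x|^m)] with
   [m <= size b] has an interpolant of size [O(s^(m - 2))]. *)
Definition good_nodes n (x : R) (b : seq R) :=
  [/\ anchored x b, (n <= size b)%N, sc x <= 1 &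
    exists2 A, 1 <= A & {in b, forall y, `|y - x| <= A * sc x} /\
      forall k z, `|z - x| <= sc x / 4 ->
        A ^+ size b * \sum_(y <- b) `|(lagr b y)^`(k).[z]| <= k`!%:R / sc x ^+ k.+2].

End nodes.

(** * Continuity in the Fréchet and quotient topologies *)

Section Cinfty_topology.
Variable R : realType.

Lemma Cinfty_smoothP (F : Cinfty R) : smooth F.
Proof. by have := Cinfty_smooth F; rewrite inE. Qed.

Lemma Cinfty_subE (F G : Cinfty R) : (F - G : Cinfty R) = (F : R -> R) - G :> (R -> R).
Proof. by rewrite -[LHS]/(val (F - G)) raddfB. Qed.

Lemma nbhs_derivatives (F0 : Cinfty R) j (r e : R) : 0 < e ->
  nbhs F0 [set G : Cinfty R |
    forall x, `|x| <= r -> `|derive1n j F0 x - derive1n j G x| < e].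
Proof.
move=> e0.
have c1 := @initial_continuous _ _ (@derivatives R) F0.
have c2 := @proj_continuous nat (fun _ : nat => {family compact, R -> R}) j
  (derivatives F0).
have cA : compact [set x : R | `|x| <= r].
  rewrite (_ : [set x | _] = `[(- r)%R, r]%classic); first exact: segment_compact.
  by apply/seteqP; split=> x /=; rewrite in_itv/= ler_norml.
have := @fam_nbhs R R compact _ [set p | ball p.1 e p.2]
  (derive1n j F0 : {family compact, R -> R}) _ cA.
move=> /(_ (entourage_ball _ (PosNum e0))) /c2 /c1.
move=> h; have {}h : nbhs F0 (@derivatives R @^-1` (proj j @^-1` _)) := h.
apply: filterS h => G /= H x xr.
by have := H x xr; rewrite -ball_normE.
Qed.

(** By linearity it is enough to bound each seminorm of the image by finitely many seminorms of the
    argument. *)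
Lemma continuous_Cinfty (V : {linear Cinfty R -> Cinfty R}) :
    (forall k (r : R), exists C m (r' : R), 0 <= C /\ forall (F : Cinfty R) (M : R), 0 <= M ->
      (forall j x, (j <= m)%N -> `|x| <= r' -> `|derive1n j F x| <= M) ->
      forall x, `|x| <= r -> `|derive1n k (V F) x| <= C * M) ->
  continuous V.
Proof.
move=> HV; apply: continuous_comp_initial => F0.
have FF : Filter ((@derivatives R \o V) x @[x --> F0]) := fmap_filter _ (nbhs_filter F0).
(* The target topology is initial for a product, so each derivative is treated alone, on one compact
   set. *)
apply/cvg_sup => k; move: F0 {FF}; apply: continuous_comp_initial => F0.
have FF0 : ProperFilter (nbhs F0) := nbhs_pfilter F0.
apply/(@fam_cvgP R R compact ((fun G : Cinfty R => derive1n k (V G) : R -> R) x @[x --> F0])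
  (derive1n k (V F0)) (fmap_filter _ FF0)) => A cA P /= /uniform_nbhs[E [entE EP]].
have [e /= e0 eE] : exists2 e : R, 0 < e & [set p : R * R | ball p.1 e p.2] `<=` E.
  by move: entE; rewrite -entourage_ballE.
have [r rA] : exists r, forall x, A x -> `|x| <= r.
  by have [r [_ rA]] := compact_bounded cA; exists (r + 1); apply: rA; rewrite ltrDl.
have [C [m [r' [C0 H]]]] := HV k r.
have d0 : 0 < e / (C + 1) by rewrite divr_gt0// ltr_wpDl.
near=> G; apply: EP => x Ax; apply: eE => /=.
rewrite -ball_normE/= /derivatives.
have -> : derive1n k (V F0) x - derive1n k (V G) x = derive1n k (V (F0 - G)) x.
  have -> : Cinfty_fun (V (F0 - G)) = (V F0 : R -> R) - V G.
    by rewrite -Cinfty_subE; congr Cinfty_fun; exact: linearB.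
  by rewrite derive1nB//; exact: Cinfty_smoothP.
(* Finitely many neighbourhoods, one per order, are intersected by induction. *)
have HG : forall j, (j < m.+1)%N -> forall x, `|x| <= r' ->
    `|derive1n j F0 x - derive1n j G x| < e / (C + 1).
  near: G; elim: m.+1 => [|n IH]; first exact: nearW.
  near=> G => j; rewrite ltnS leq_eqVlt => /predU1P[->|]; last first.
    by move: j; near: G; exact: IH.
  by near: G; exact: nbhs_derivatives.
apply: (@le_lt_trans _ _ (C * (e / (C + 1)))).
  apply: H (rA _ Ax); first exact: ltW.
  move=> j y jm yr; rewrite Cinfty_subE derive1nB; [|exact: Cinfty_smoothP..].
  exact/ltW/HG.
by rewrite mulrCA gtr_pMr// ltr_pdivrMr ?mul1r ?ltrDl// ltr_wpDl.
Unshelve. all: by end_near. Qed.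

(* [E f := T (any extension of f)] is well defined since [T] kills the functions vanishing
   on [K]. *)
Lemma smooth_extension_of_operator (K : set R) (T : {linear Cinfty R -> Cinfty R}) :
    continuous T ->
    (forall F : Cinfty R, (forall x, K x -> F x = 0) -> T F = 0) ->
    (forall (F : Cinfty R) x, K x -> T F x = F x) ->
  smooth_extension_property K.
Proof.
move=> cT T0 TK.
have ext (f : Cinfty_on K) : exists F : Cinfty R, restr K F = f.
  have := Cinfty_on_smooth f; rewrite inE => -[F sF fF].
  have pF : F \in @smooth_pred R by rewrite inE.
  by exists (MkCinfty pF); apply: val_inj.
have {ext}[e eK] := choice ext.
have Te (F G : Cinfty R) : (forall x, K x -> F x = G x) -> T F = T G.
  move=> FG; apply/eqP; rewrite -subr_eq0 -linearB T0// => x Kx.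
  by rewrite Cinfty_subE fctE FG ?subrr.
have restrE (F G : Cinfty R) : restr K F = restr K G -> forall x, K x -> F x = G x.
  move=> FG x Kx; have xK : x \in K by rewrite inE.
  have := congr1 (fun h : Cinfty_on K => h (SigSub xK)) FG.
  by [].
have lin : linear (T \o e).
  move=> c f g; rewrite /= -linearP; apply: Te => x Kx.
  apply: restrE Kx; rewrite eK; apply: val_inj; apply/funext => y /=.
  have := congr1 (fun h : Cinfty_on K => h y) (eK f).
  have := congr1 (fun h : Cinfty_on K => h y) (eK g).
  move=> /= Eg Ef.
  have E1 : Cinfty_on_fun (c *: f + g) = c *: (f : K -> R) + g.
    by rewrite -[LHS]/(val (c *: f + g)) linearP.
  have E2 : Cinfty_fun (c *: e f + e g) = c *: (e f : R -> R) + e g.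
    by rewrite -[LHS]/(val (c *: e f + e g)) linearP.
  rewrite -[LHS]/(Cinfty_on_fun (c *: f + g) y).
  by rewrite -[RHS]/(Cinfty_fun (c *: e f + e g) (val y)) E1 E2 !fctE Ef Eg.
pose B := GRing.isLinear.Build R (Cinfty_on K) (Cinfty R) *:%R (T \o e) lin.
pose E : {linear Cinfty_on K -> Cinfty R} := HB.pack (T \o e) B.
exists E; split.
  apply/continuousP => U oU.
  (* In the quotient topology one looks at [E] after restriction, which is [T] because [T] only sees
     values on [K]. *)
  rewrite /open/= /Cinfty_on_open.
  rewrite (_ : _ @^-1` _ = T @^-1` U); first by move/continuousP : cT; exact.
  apply/seteqP; split => F /=; rewrite (Te (e (restr K F)) F)//.
    by apply: restrE; rewrite eK.
  by apply: restrE; rewrite eK.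
move=> f; rewrite -[RHS]eK; apply: val_inj; apply/funext => y /=.
by apply: TK; have := valP y; rewrite inE.
Qed.

End Cinfty_topology.

(** * Scale and interpolation nodes of a convex null sequence *)

Section scale.
Variables (R : realType) (a : R^nat).
Hypothesis a_gt0 : forall l, 0 < a l.
Hypothesis a_decr : nonincreasing_seq a.
Hypothesis a_convex : convex_seq a.
Hypothesis a_null : a @ \oo --> (0 : R).
Hypothesis a_bounded : forall p : R, 1 < p ->
  bounded_fun (fun l : nat => a l `^ p / a l.+1).

Definition gap l := a l - a l.+1.

Lemma gap_ge0 l : 0 <= gap l.
Proof. by rewrite subr_ge0; exact: a_decr. Qed.

Lemma gap_noninc i j : (i <= j)%N -> gap j <= gap i.
Proof. exact: a_convex. Qed.

Lemma gap_le i j : (i < j)%N -> gap i <= a i - a j.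
Proof. by move=> ij; rewrite lerB//; exact: a_decr. Qed.

Lemma gap_le_a l : gap l <= a l.
Proof. by rewrite gerBl ltW. Qed.

Lemma a_small e : 0 < e -> exists l, a l < e.
Proof.
move=> e0; have /cvgrPdist_lt /(_ e e0) [N _ HN] := a_null.
exists N; have := HN N (leqnn N).
by rewrite /= sub0r normrN ger0_norm// ltW.
Qed.

(** By convexity a zero gap makes all later gaps zero; the sequence would then stay at a positive
    value. *)
Lemma gap_gt0 l : 0 < gap l.
Proof.
rewrite lt_neqAle gap_ge0 andbT eq_sym; apply/negP => /eqP d0.
have ac n : a (l + n)%N = a l.
  elim: n => [|n IH]; first by rewrite addn0.
  have := gap_noninc (leq_addr n l); rewrite d0 => dn.
  have : gap (l + n) = 0 by apply/eqP; rewrite eq_le dn gap_ge0.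
  by rewrite addnS /gap IH => /eqP; rewrite subr_eq0 => /eqP.
have [m am] := a_small (a_gt0 l).
have : a (l + m)%N <= a m by apply: a_decr; rewrite leq_addl.
by rewrite ac leNgt am.
Qed.

(** Rounding down to the sequence: the first term at most [y] is also the largest such term, and its
    predecessor exceeds [y]. *)
Lemma floor_index : exists fl : R -> nat, forall y, 0 < y ->
  a (fl y) <= y /\ forall i, a i <= y -> (fl y <= i)%N.
Proof.
suff H y : exists j, 0 < y -> a j <= y /\ forall i, a i <= y -> (j <= i)%N.
  by have [fl Hfl] := choice H; exists fl.
have [y0|y0] := ltP 0 y; last by exists 0%N.
have ex : exists i, a i <= y by have [i /ltW ai] := a_small y0; exists i.
by case: (ex_minnP ex) => j aj jmin; exists j.
Qed.

(* Up to constants, the smallest [s] such that some [a l] is within [s] of [x] and all gaps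
   of [K] to the left of [a l] are at most [s]. *)
Definition scale (x : R) := inf (range (fun l => Num.max `|x - a l| (gap l))).

Lemma scale_le x l : scale x <= Num.max `|x - a l| (gap l).
Proof.
apply: ge_inf; last by exists l.
by exists 0 => _ [j _ <-]; rewrite le_max normr_ge0.
Qed.

Lemma scale_ge x m : (forall l, m <= Num.max `|x - a l| (gap l)) -> m <= scale x.
Proof.
move=> h; apply: lb_le_inf; first by exists (Num.max `|x - a 0%N| (gap 0)); exists 0%N.
by move=> _ [l _ <-].
Qed.

Lemma scale_ge0 x : 0 <= scale x.
Proof. by apply: scale_ge => l; rewrite le_max normr_ge0. Qed.

Lemma scale_le_norm x : scale x <= `|x|.
Proof.
apply/ler_addgt0Pr => e e0; have [l al] := a_small e0.
apply: (le_trans (scale_le x l)); rewrite ge_max; apply/andP; split.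
  by rewrite (le_trans (ler_normB _ _))// lerD2l (ger0_norm (ltW (a_gt0 l))) ltW.
by rewrite (le_trans (gap_le_a l))// (le_trans (ltW al))// lerDr.
Qed.

Lemma scale_lip x y : scale x <= scale y + `|x - y|.
Proof.
rewrite -lerBlDr; apply: scale_ge => l; rewrite lerBlDr.
apply: (le_trans (scale_le x l)); rewrite ge_max; apply/andP; split.
  rewrite (le_trans (ler_distD y _ _))// addrC lerD2r.
  by rewrite le_max lexx.
by rewrite (@le_trans _ _ (Num.max `|y - a l| (gap l)))// ?le_max ?lexx ?orbT// lerDl.
Qed.

(** Indices up to N are controlled by gap N, later ones by their distance to [x], since then a l <=
    |x| / 2. *)
Lemma scale_gt0 x : x != 0 -> 0 < scale x.
Proof.
move=> x0; have x20 : 0 < `|x| / 2 by rewrite divr_gt0 ?normr_gt0.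
have [N aN] := a_small x20.
apply: (@lt_le_trans _ _ (Num.min (`|x| / 2) (gap N))).
  by rewrite lt_min x20 gap_gt0.
apply: scale_ge => l; rewrite ge_min; have [lN|Nl] := leqP l N.
  by rewrite orbC le_max gap_noninc// orbT.
rewrite le_max; apply/orP; left; apply/orP; left.
have al : a l <= `|x| / 2 by rewrite (le_trans _ (ltW aN))//; apply: a_decr; exact: ltnW.
have := lerB_dist x (a l); rewrite (ger0_norm (ltW (a_gt0 l))); lra.
Qed.

(** The infimum gives an index with both quantities at most 2 s. A term within s / 4 of [x] has gap
    at least s, so there is at most one; if it exists it is taken as [l], and comparison with the
    first index bounds its gap by 3 s. *)
Lemma scale_near x : x != 0 -> exists l,
  [/\ `|x - a l| <= 2 * scale x, gap l <= 3 * scale x &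
      forall j, `|a j - x| <= scale x / 4 -> j = l].
Proof.
move=> x0; have s0 := scale_gt0 x0; set s := scale x in s0 *.
have [l xl dl] : exists2 l, `|x - a l| <= 2 * s & gap l <= 2 * s.
  apply: contrapT => H; have : 2 * s <= s.
    apply: scale_ge => l; rewrite le_max; have [xl|/ltW ->//] := leP `|x - a l| (2 * s).
    have [dl|/ltW ->] := leP (gap l) (2 * s); last by rewrite orbT.
    by case: H; exists l.
  lra.
have gapj j : `|a j - x| <= s / 4 -> s <= gap j.
  move=> jx; have := scale_le x j; rewrite le_max -/s distrC => /orP[|//].
  by move=> sx; exfalso; lra.
have [[j jx]|nj] := pselect (exists j, `|a j - x| <= s / 4); last first.
  exists l; split=> // [|j jx]; first by lra.
  by exfalso; apply: nj; exists j.
exists j; split.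
- by rewrite distrC; lra.
- have [lj|jl|<-] := ltngtP l j; last by lra.
    by rewrite (le_trans (gap_noninc (ltnW lj)))//; lra.
  have := gap_le jl; have := ler_distD x (a j) (a l).
  have := ler_norm (a j - a l); lra.
- have far i k : (i < k)%N -> `|a i - x| <= s / 4 -> `|a k - x| <= s / 4 -> False.
    move=> ik ix kx; have := gap_le ik; have := gapj i ix.
    have := ler_distD x (a i) (a k); rewrite (distrC x).
    have := ler_norm (a i - a k); lra.
  move=> i ix; have [ij|ji|//] := ltngtP i j; exfalso.
    exact: far ij ix jx.
  exact: far ji jx ix.
Qed.

(** The largest term at most [y] has a predecessor at least [y], to which the growth condition
    applies. If it is the first term, the entry [a 0] of the constant takes over. *)
Lemma next_point (p : R) : 1 < p -> exists c : R, 0 < c <= 1 /\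
  forall y : R, 0 < y <= 1 -> exists j, c * y `^ p <= a j <= y.
Proof.
move=> p1; have [M [_ HM]] := a_bounded p1.
have := HM (Num.max M 0 + 1); rewrite (le_lt_trans (_ : M <= Num.max M 0)) ?ltrDl ?le_max ?lexx//.
move=> /(_ isT); set C := _ + 1 => HC.
have C0 : 0 < C by rewrite /C ltr_wpDl// le_max lexx orbT.
have aC l : C^-1 * a l `^ p <= a l.+1.
  have h : a l `^ p / a l.+1 <= C := le_trans (ler_norm _) (HC l Logic.I).
  by rewrite mulrC ler_pdivrMr// mulrC -ler_pdivrMr.
exists (Num.min 1 (Num.min (a 0%N) C^-1)).
rewrite !lt_min ltr01 a_gt0 invr_gt0 C0 ge_min lexx; split=> // y /andP[y0 y1].
set c := Num.min _ _.
have p0 : 0 <= p by lra.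
have yp : y `^ p <= 1.
  by rewrite (le_trans (ge1r_powR _ (ltW p1)))// y0.
have [fl Hfl] := floor_index; have [afl flmin] := Hfl y y0.
exists (fl y); rewrite afl andbT.
case: (fl y) flmin => [_|j flmin].
  rewrite -[leRHS]mulr1 ler_pM ?powR_ge0// /c ?le_min ?ler01 ?(ltW (a_gt0 _)) ?invr_ge0 ?(ltW C0)//.
  by rewrite !ge_min lexx orbT.
have ay : y <= a j.
  by rewrite leNgt; apply/negP => /ltW /flmin; rewrite ltnn.
apply: le_trans (aC j); rewrite ler_pM ?powR_ge0//.
- by rewrite !le_min ler01 (ltW (a_gt0 _)) invr_ge0 ltW.
- by rewrite !ge_min lexx !orbT.
- by rewrite ge0_ler_powR// nnegrE// ltW.
Qed.

(** Each point is at most half the previous one, so a difference is no smaller than the smaller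
    point. With q^2 = p, the first step costs an exponent q and the induction hypothesis the
    other. *)
Lemma halving_points n (p : R) : 1 < p -> exists c : R, 0 < c <= 1 /\
  forall y : R, 0 < y <= 1 -> exists b : seq R,
    [/\ uniq b, size b = n,
        {in b, forall z, range a z /\ c * y `^ p <= z <= y} &
        {in b &, forall z z' : R, z' != z -> c * y `^ p <= `|z - z'|}].
Proof.
elim: n p => [|n IH] p p1.
  by exists 1; rewrite ltr01 lexx; split=> // y _; exists [::]; split.
pose q := Num.sqrt p.
have q1 : 1 < q by rewrite -sqrtr1 ltr_sqrt// (lt_trans _ p1).
have qq : q * q = p by rewrite -expr2 sqr_sqrtr// ltW// (lt_trans _ p1).
have [c1 [/andP[c10 c11] H1]] := next_point q1.
have [c2 [/andP[c20 c21] H2]] := IH q q1.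
have c12 : 0 < (c1 / 2) `^ q <= 1.
  rewrite powR_gt0 ?divr_gt0//= (le_trans (ge1r_powR _ (ltW q1)))//; last by lra.
  by apply/andP; split; lra.
exists (c2 * (c1 / 2) `^ q); split.
  by move/andP : c12 => [h1 h2]; rewrite mulr_gt0//= mulr_ile1// ltW.
move=> y y01; have [j /andP[aj jy]] := H1 y y01.
pose y' := a j / 2.
have y'0 : 0 < y' by rewrite divr_gt0.
have y'1 : y' <= 1 by rewrite /y'; move: y01 => /andP[_]; have := a_gt0 j; lra.
have y'01 : 0 < y' <= 1 by rewrite y'0.
have lowy : (c1 / 2) `^ q * y `^ p <= y' `^ q.
  rewrite -qq powRrM -powRM ?powR_ge0//; last by rewrite divr_ge0// ltW.
  rewrite ge0_ler_powR ?nnegrE ?(ltW y'0)//; [by lra| |rewrite /y'; lra].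
  by rewrite mulr_ge0 ?powR_ge0// divr_ge0// ltW.
have low : c2 * (c1 / 2) `^ q * y `^ p <= c2 * y' `^ q by rewrite -mulrA ler_wpM2l// ltW.
have lowy' : c2 * y' `^ q <= y'.
  rewrite (le_trans _ (ge1r_powR y'01 (ltW q1)))// -[leRHS]mul1r.
  by rewrite ler_wpM2r// powR_ge0.
have [b [ub sb Hb sepb]] := H2 y' y'01.
have far z : z \in b -> c2 * (c1 / 2) `^ q * y `^ p <= a j - z.
  move=> /Hb[_ /andP[_ zy']]; apply: (le_trans low); apply: (le_trans lowy').
  by rewrite /y' in zy' *; lra.
have pos : 0 < c2 * (c1 / 2) `^ q * y `^ p.
  move/andP : y01 => [y0 _]; move/andP : c12 => [h1 _].
  by apply: mulr_gt0; [exact: mulr_gt0|exact: powR_gt0].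
exists (a j :: b); split.
- rewrite /= ub andbT; apply/negP => /far; rewrite subrr leNgt.
  by rewrite pos.
- by rewrite /= sb.
- move=> z; rewrite inE => /predU1P[->|/[dup] zb /Hb[rz /andP[zl zu]]].
    split; first by exists j.
    rewrite jy andbT (le_trans low)// (le_trans lowy')// /y'.
    by have := a_gt0 j; lra.
  split=> //; rewrite (le_trans low zl)/= (le_trans zu)// (le_trans _ jy)// /y'.
  by have := a_gt0 j; lra.
- move=> z z'; rewrite !inE => /predU1P[->|zb] /predU1P[->|zb'] zz'.
  + by rewrite eqxx in zz'.
  + by rewrite (le_trans (far _ zb'))// ler_norm.
  + by rewrite distrC (le_trans (far _ zb))// ler_norm.
  + by rewrite (le_trans low)// sepb.
Qed.

(* [scale x * thin n x] is [scale x] to the power [1 + 1 / (n + 1)]. *)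
Definition thin n (x : R) := scale x `^ n.+1%:R^-1.

Lemma thinX n x : thin n x ^+ n.+1 = scale x.
Proof.
rewrite /thin -powR_mulrn ?powR_ge0// -powRrM mulVf ?pnatr_eq0//.
by rewrite powRr1// scale_ge0.
Qed.

(* If [a l >= 6 (n + 1) s], the points of [K] closest to [a l - 6 i s] from below are good
   nodes, because the gaps of [K] below [a l] are at most [3 s]. *)
Lemma separated_nodes_dense n l s x : 0 < s -> `|x - a l| <= 2 * s -> gap l <= 3 * s ->
    6 * n.+1%:R * s <= a l -> exists b : seq R,
  [/\ uniq b, size b = n.+1, a l \in b, {in b, forall z, range a z} &
      {in b, forall z, `|z - x| <= (6 * n.+1%:R + 5) * s} /\
      {in b &, forall z z' : R, z' != z -> s <= `|z - z'|}].
Proof.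
move=> s0 xl dl al.
have [fl Hfl] := floor_index.
(* Rounding down to the sequence moves [y i] by at most 3 s, so a spacing of 6 s keeps the nodes
   apart. *)
pose y (i : nat) := a l - 6 * i%:R * s.
have y0 i : (i <= n)%N -> 0 < y i.
  move=> iN; rewrite /y subr_gt0; apply: lt_le_trans al.
  by rewrite ltr_pM2r// ltr_pM2l// ltr_nat ltnS.
have ybase i : y i <= a l by rewrite /y gerBl !mulr_ge0// ltW.
have ylow i : (i <= n)%N -> y i - 3 * s <= a (fl (y i)) <= y i.
  move=> iN; have [ay ymin] := Hfl _ (y0 i iN); rewrite ay andbT.
  have [fll|lfl] := leqP (fl (y i)) l.
    have := a_decr fll; have := ybase i; lra.
  have [j fj] : exists j, fl (y i) = j.+1 by case: (fl (y i)) lfl => // j; exists j.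
  rewrite fj in lfl ymin *.
  have yj : y i <= a j by rewrite leNgt; apply/negP => /ltW /ymin; rewrite ltnn.
  have := gap_noninc (lfl : (l <= j)%N); rewrite {1}/gap; lra.
have sep i j : (i <= n)%N -> (j <= n)%N -> (i < j)%N -> s <= a (fl (y i)) - a (fl (y j)).
  move=> iN jN ij; have /andP[h1 _] := ylow i iN; have /andP[_ h2] := ylow j jN.
  have : y j <= y i - 6 * s.
    have : (i.+1%:R : R) <= j%:R by rewrite ler_nat.
    rewrite -natr1 => /(ler_wpM2r (ltW s0)); rewrite /y; lra.
  lra.
pose g i := a (fl (y i)).
have gsep i j : (i <= n)%N -> (j <= n)%N -> i != j -> s <= `|g i - g j|.
  move=> iN jN; rewrite neq_ltn => /orP[ij|ji].
    by rewrite (le_trans (sep i j iN jN ij))// ler_norm.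
  by rewrite distrC (le_trans (sep j i jN iN ji))// ler_norm.
have in_iota i : i \in iota 0 n.+1 -> (i <= n)%N by rewrite mem_iota add0n.
exists [seq g i | i <- iota 0 n.+1]; split.
- rewrite map_inj_in_uniq ?iota_uniq// => i j /in_iota iN /in_iota jN gij.
  apply/eqP; apply: contraT => /(gsep i j iN jN); rewrite gij subrr normr0.
  by rewrite leNgt s0.
- by rewrite size_map size_iota.
- apply/mapP; exists 0%N; first by rewrite mem_iota.
  rewrite /g /y mulr0 mul0r subr0; have [h1 h2] := Hfl _ (a_gt0 l).
  by apply/eqP; rewrite eq_le h1 andbT; apply: a_decr; exact: h2.
- by move=> z /mapP[i _ ->]; exists (fl (y i)).
split.
- move=> z /mapP[i /in_iota iN ->]; have /andP[h1 h2] := ylow i iN.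
  have h3 : i%:R * s <= n.+1%:R * s by rewrite ler_wpM2r ?(ltW s0)// ler_nat ltnW.
  have h4 : 0 <= n.+1%:R * s by rewrite mulr_ge0// ltW.
  have h5 : 0 <= i%:R * s by rewrite mulr_ge0// ltW.
  move: xl; rewrite !ler_norml /g => /andP[h6 h7].
  by move: h1 h2; rewrite /y => h1 h2; apply/andP; split; lra.
- move=> z z' /mapP[i /in_iota iN ->] /mapP[j /in_iota jN ->] ij.
  by apply: gsep => //; apply: contraNneq ij => ->.
Qed.

(* Where the sequence is too sparse for equidistant nodes, [x] is of the order of [scale x]
   and one uses points of [K] that at least halve from one to the next; these do not decay
   too fast since [a_(l+1) >= c a_l^p] for every [p > 1]. *)
Lemma separated_nodes n : exists A c : R, [/\ 1 <= A, 0 < c <= 1 &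
  forall x, 0 < scale x <= 1 -> exists b : seq R,
    [/\ uniq b, size b = n.+1, {in b, forall z, range a z},
        (forall j, `|a j - x| <= scale x / 4 -> a j \in b) &
        {in b, forall z, `|z - x| <= A * scale x} /\
        {in b &, forall z z' : R, z' != z -> c * scale x * thin n x <= `|z - z'|}]].
Proof.
(* With this exponent s^p = s * thin n x. *)
pose p : R := 1 + n.+1%:R^-1.
have p1 : 1 < p by rewrite ltrDl invr_gt0.
have [c1 [/andP[c10 c11] H1]] := halving_points n p1.
have [c2 [/andP[c20 c21] H2]] := halving_points n.+1 p1.
have h2p : 0 < (2^-1 : R) `^ p <= 1.
  rewrite powR_gt0//= (le_trans (ge1r_powR _ (ltW p1)))//; last lra.
  by apply/andP; split; lra.
(* The halving points start at s / 2, whose p-th power is 2^(-p) s t; this factor also makes c at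
   most 1 / 2. *)
pose c := Num.min c1 c2 * (2^-1 : R) `^ p.
have c0 : 0 < c by case/andP : h2p => h _; rewrite mulr_gt0// lt_min c10.
have cle1 : c <= 1.
  case/andP : h2p => h h'; rewrite mulr_ile1 ?(ltW h)// ?ge_min ?c11//.
  by rewrite le_min !ltW.
have ch : c <= 2^-1.
  have h : (2^-1 : R) `^ p <= 2^-1.
    by rewrite ge1r_powR ?(ltW p1)//; apply/andP; split; lra.
  apply: le_trans h; case/andP : h2p => h _.
  by rewrite ler_piMl ?(ltW h)// ge_min c11.
exists (6 * n.+1%:R + 5), c; split; first by have := ler0n R n.+1; lra.
  by rewrite c0.
move=> x /andP[s0 s1].
have x0 : x != 0.
  by apply: contraTneq s0 => ->; rewrite -leNgt (le_trans (scale_le_norm 0))// normr0.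
set s := scale x in s0 s1 *; set t := thin n x.
have st : s * t = s `^ p.
  rewrite /t /thin -/s /p powRD ?powRr1 ?(ltW s0)//.
  by apply/implyP => _; rewrite gt_eqF.
have st_le : s * t <= s by rewrite st ge1r_powR ?s0// ltW.
have st0 : 0 < s * t by rewrite st powR_gt0.
have [l [xl dl lP]] := scale_near x0; rewrite -/s in xl dl lP.
have csep z : s / 2 <= z -> c * s * t <= z.
  move=> sz; rewrite -mulrA (le_trans _ sz)// mulrC.
  by rewrite ler_pM ?(ltW st0) ?(ltW c0).
have [al|al] := leP (6 * n.+1%:R * s) (a l).
  have [b [ub sb lb bK [bx bsep]]] := separated_nodes_dense s0 xl dl al.
  exists b; split=> //; first by move=> j /lP ->.
  split=> // z z' zb z'b zz'; apply: csep.
  by apply: le_trans (bsep z z' zb z'b zz'); lra.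
(* From here on a l < 6 (n + 1) s, so |x| = O(s) and all points of [0, s / 2] are close enough to
   [x]. *)
have n0 : 0 <= n.+1%:R * s by rewrite mulr_ge0// ltW.
have s2 : 0 < s / 2 <= 1 by apply/andP; split; lra.
have s2p : (s / 2) `^ p = 2^-1 `^ p * (s * t).
  by rewrite powRM ?(ltW s0)// st mulrC.
have cle (k : R) : 0 < k -> Num.min c1 c2 <= k -> c * s * t <= k * (s / 2) `^ p.
  move=> k0 hk; rewrite s2p /c -!mulrA ler_wpM2r// !mulr_ge0 ?powR_ge0 ?(ltW s0)//.
have far z : z <= s / 2 -> 0 <= z -> `|z - x| <= (6 * n.+1%:R + 5) * s.
  move=> zs z0; move: xl; rewrite !ler_norml => /andP[h6 h7].
  have := a_gt0 l.
  by move=> h8; apply/andP; split; lra.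
have pos (k : R) : 0 < k -> 0 <= k * (s / 2) `^ p.
  by move=> k0; rewrite mulr_ge0 ?powR_ge0// ltW.
have [[j jx]|nj] := pselect (exists j, `|a j - x| <= s / 4); last first.
  have [b [ub sb Hb sepb]] := H2 _ s2.
  exists b; split=> //.
  - by move=> z /Hb[].
  - by move=> i ix; exfalso; apply: nj; exists i.
  - split=> [z /Hb[_ /andP[zl zu]]|z z' zb z'b zz'].
      by apply: far => //; exact: le_trans (pos _ c20) zl.
    by apply: le_trans (sepb z z' zb z'b zz'); apply: cle => //; rewrite ge_min lexx orbT.
have jl := lP j jx; subst j.
have sal : s <= a l.
  have := scale_le x l; rewrite le_max -/s distrC => /orP[sx|/le_trans -> //]; last first.
    exact: gap_le_a.
  by exfalso; lra.
(* The mandatory node [a l] is at least s, so n further points in (0, s / 2] stay s / 2 away from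
   it. *)
have [b [ub sb Hb sepb]] := H1 _ s2.
have bl z : z \in b -> s / 2 <= a l - z by move=> /Hb[_ /andP[_ zu]]; lra.
exists (a l :: b); split.
- by rewrite /= ub andbT; apply/negP => /bl; rewrite subrr; lra.
- by rewrite /= sb.
- by move=> z; rewrite inE => /predU1P[->|/Hb[]//]; exists l.
- by move=> i /lP ->; rewrite mem_head.
- split=> [z|z z'].
    rewrite inE => /predU1P[->|/Hb[_ /andP[zl zu]]].
      by rewrite distrC (le_trans xl)// ler_wpM2r ?(ltW s0)//; have := ler0n R n.+1; lra.
    by apply: far => //; exact: le_trans (pos _ c10) zl.
  rewrite !inE => /predU1P[->|zb] /predU1P[->|z'b] zz'.
  + by rewrite eqxx in zz'.
  + by apply: csep; rewrite (le_trans (bl _ z'b))// ler_norm.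
  + by apply: csep; rewrite distrC (le_trans (bl _ zb))// ler_norm.
  + by apply: le_trans (sepb z z' zb z'b zz'); apply: cle => //; rewrite ge_min lexx.
Qed.

(** The point 0 is never within scale x / 4, since scale x <= |x|. These nodes serve the pieces
    where the scale is too large for good ones. *)
Lemma anchored_exists x : x != 0 -> exists b, anchored ([set 0] `|` range a) scale x b.
Proof.
move=> x0; have [l [_ _ lP]] := scale_near x0; exists [:: a l]; split=> //.
  by move=> z; rewrite inE => /eqP ->; right; exists l.
move=> y [->|[j _ <-] /lP ->]; last by rewrite mem_head.
rewrite sub0r normrN => xs; have := scale_le_norm x; have : 0 < `|x| by rewrite normr_gt0.
by move=> h1 h2; exfalso; lra.
Qed.

(** With L = (A + 1) s and eta = c s t, the factor (2 L / eta)^(n + 1) of [lagr_le] is a constant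
    over t^(n + 1) = s: only one power of s is lost. All constants go into [C], and C s <= 1 trades
    them for a second power. *)
Lemma good_nodes_exist n : exists2 s0, 0 < s0 &
  forall x, 0 < scale x <= s0 -> exists b, good_nodes ([set 0] `|` range a) scale n x b.
Proof.
have [A [c [A1 /andP[c0 c1] H]]] := separated_nodes n.
have A0 : 0 < A by lra.
pose C := A ^+ n.+1 * n.+1%:R * (2 * (A + 1) / c) ^+ n.+1.
have C0 : 0 < C.
  by rewrite !mulr_gt0 ?exprn_gt0// mulr_gt0 ?invr_gt0// mulr_gt0//; lra.
exists (Num.min 1 C^-1); first by rewrite lt_min ltr01 invr_gt0.
move=> x /andP[s0]; rewrite le_min => /andP[s1 sC].
have [|b [ub sb bK ba [bx bsep]]] := H x; first by rewrite s0.
exists b; split=> //; last 1 first.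
- exists A => //; split=> // k z zx.
  set s := scale x in s0 s1 sC bx bsep ba zx *; set t := thin n x in bsep.
  have ts : t ^+ n.+1 = s := thinX n x.
  have t0 : 0 < t by rewrite /t /thin powR_gt0.
  have t1 : t <= 1.
    by rewrite -(@ler_pXn2r _ n.+1) ?nnegrE ?(ltW t0)// expr1n ts.
  pose L := (A + 1) * s; pose eta := c * s * t.
  have eta0 : 0 < eta by rewrite !mulr_gt0.
  have sL : s <= L by rewrite ler_peMl ?(ltW s0)//; lra.
  have etaL : eta <= L.
    rewrite (le_trans _ sL)// /eta -mulrA mulrCA ler_piMr ?(ltW s0)//.
    by rewrite mulr_ile1 ?(ltW c0) ?(ltW t0).
  have lag y : y \in b -> `|(lagr b y)^`(k).[z]| <=
      (2 * (A + 1) / c) ^+ n.+1 / s * k`!%:R / s ^+ k.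
    move=> yb.
    have h1 : {in b, forall u, u != y -> eta <= `|y - u|}.
      by move=> u ub' uy; exact: bsep.
    have h2 : {in b, forall u, `|z - u| <= L}.
      move=> u ub'; rewrite /L mulrDl mul1r [leRHS]addrC.
      rewrite (le_trans (ler_distD x _ _))// lerD//; first by lra.
      by rewrite distrC bx.
    apply: (le_trans (lagr_le k eta0 etaL h1 h2)); rewrite sb.
    have -> : 2 * L / eta = 2 * (A + 1) / c / t.
      by rewrite /L /eta; field; rewrite !gt_eqF.
    have B0 : 0 <= (2 * (A + 1) / c) ^+ n.+1.
      by rewrite exprn_ge0// divr_ge0 ?(ltW c0)//; lra.
    rewrite [in leLHS]exprMn exprVn ts -[leLHS]mulrA -[leRHS]mulrA ler_wpM2l//.
      by rewrite divr_ge0// ltW.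
    rewrite ler_wpM2l// lef_pV2 ?posrE ?exprn_gt0 ?(lt_le_trans s0)//.
    by apply: lerXn2r; rewrite ?nnegrE ?(ltW s0)// (le_trans _ sL)// ltW.
  apply: (@le_trans _ _ (A ^+ n.+1 *
      (((2 * (A + 1) / c) ^+ n.+1 / s * k`!%:R / s ^+ k) *+ n.+1))).
    rewrite sb ler_wpM2l ?exprn_ge0 ?(ltW A0)// big_seq.
    apply: (le_trans (ler_sum _ lag)).
    by rewrite -big_seq big_const_seq count_predT sb iter_addr_0.
  have -> : A ^+ n.+1 * (((2 * (A + 1) / c) ^+ n.+1 / s * k`!%:R / s ^+ k) *+ n.+1) =
      (C * s) * (k`!%:R / s ^+ k.+2).
    rewrite -[X in _ * X]mulr_natr /C !exprS; field.
    by rewrite !gt_eqF// exprn_gt0.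
  rewrite ler_piMl ?divr_ge0 ?exprn_ge0 ?(ltW s0)//.
  by move: sC; rewrite -[C^-1]mul1r ler_pdivlMr// mulrC.
- split=> //; first by move=> y /bK ?; right.
  move=> y [->|[j _ <-]]; last exact: ba.
  rewrite sub0r normrN => xs; exfalso; move: xs s0; have := scale_le_norm x; lra.
- by rewrite sb.
Qed.

End scale.

(** * Extension to one side of the origin *)

Lemma exists_bound_upto (R : realDomainType) (P : nat -> R -> Prop) :
    (forall j C C', C <= C' -> P j C -> P j C') -> (forall j, exists C, P j C) ->
  forall k, exists2 C, 0 <= C & forall j, (j < k)%N -> P j C.
Proof.
move=> Pmono PC; elim=> [|k [C C0 HC]]; first by exists 0.
have [C' HC'] := PC k; exists (Num.max C C'); first by rewrite le_max C0.
move=> j; rewrite ltnS leq_eqVlt => /predU1P[->|jk].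
  by apply: Pmono HC'; rewrite le_max lexx orbT.
by apply: Pmono (HC j jk); rewrite le_max lexx.
Qed.

(* The numbers of nodes may thus tend to infinity along the pieces, arbitrarily slowly. *)
Lemma diagonal_choice (T : Type) (P : nat -> T -> Prop) (Q : nat -> nat -> T -> Prop) :
    (forall i, exists b, P i b) -> (forall n i b, Q n i b -> P i b) ->
    (forall n, exists N, forall i, (N <= i)%N -> exists b, Q n i b) ->
  exists bs : nat -> T, (forall i, P i (bs i)) /\
    forall m, exists N, forall i, (N <= i)%N -> exists2 n, (m <= n)%N & Q n i (bs i).
Proof.
move=> Pex QP Qex; have [N HN] := choice Qex.
have H i : exists b, P i b /\
    forall m, (m < i)%N -> (N m <= i)%N -> exists2 n, (m <= n)%N & Q n i b.
  (* Among the n < q, the last one with N n <= i wins; it is at least every earlier [m] that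
     qualifies. *)
  suff: forall q, exists b, P i b /\
      forall m, (m < q)%N -> (N m <= i)%N -> exists2 n, (m <= n)%N & Q n i b by exact.
  elim=> [|q [b [Pb Qb]]]; first by have [b Pb] := Pex i; exists b.
  have [Nq|Nq] := leqP (N q) i.
    have [b' Qb'] := HN q i Nq; exists b'; split; first exact: QP Qb'.
    by move=> m mq _; exists q.
  exists b; split=> // m; rewrite ltnS leq_eqVlt => /predU1P[->|mq]; last exact: Qb.
  by rewrite leqNgt Nq.
have [bs Hbs] := choice H; exists bs; split=> [i|m]; first by have [] := Hbs i.
exists (maxn m.+1 (N m)) => i; rewrite geq_max => /andP[mi Nmi].
by have [_] := Hbs i; exact.
Qed.

(* [sg] is [1] for the right side and [-1] for the left side. *)
Section side.
Variables (R : realType) (K : set R) (sc : R -> R) (sg tau0 rho : R) (th : R -> R).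
Hypothesis sc_le_norm : forall x, sc x <= `|x|.
Hypothesis sc_lip : forall x y, sc x <= sc y + `|x - y|.
Hypothesis sc_gt0 : forall x, x != 0 -> 0 < sc x.
Hypothesis sg_or : sg = 1 \/ sg = -1.
Hypothesis tau0_gt0 : 0 < tau0.
Hypothesis tau0_rho : 2 * tau0 <= rho.
Hypothesis K_rho : forall y, K y -> `|y| <= rho.
Hypothesis K_tau : forall y, K y -> sg * y <= tau0 - sc (sg * tau0) / 5.
Hypothesis anchored_ex : forall x, x != 0 -> exists b, anchored K sc x b.
Hypothesis good_ex : forall n, exists2 s0, 0 < s0 &
  forall x, 0 < sc x <= s0 -> exists b, good_nodes K sc n x b.
Hypothesis th_smooth : smooth th.
Hypothesis th0 : forall x, x <= 0 -> th x = 0.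
Hypothesis th1 : forall x, 1 <= x -> th x = 1.
Hypothesis th_bounded : forall k, exists C, forall x, `|derive1n k th x| <= C.

Lemma sgK x : sg * (sg * x) = x.
Proof. by case: sg_or => ->; rewrite ?mul1r// !mulN1r opprK. Qed.

Lemma norm_sgM x : `|sg * x| = `|x|.
Proof. by case: sg_or => ->; rewrite ?mul1r// mulN1r normrN. Qed.

(** The steps are a fifth of the scale; as the scale is 1-Lipschitz, it changes by at most a fifth
    of its value over a step. [K_tau] says that sg * y <= tau 1 on [K]. *)
Definition tau i := iter i (fun t => t - sc (sg * t) / 5) tau0.
Arguments tau : simpl never.

Definition step i := tau i - tau i.+1.

Lemma stepE i : step i = sc (sg * tau i) / 5.
Proof. by rewrite /step /tau iterS; ring. Qed.

Lemma tau_gt0 i : 0 < tau i.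
Proof.
elim: i => [|i IH]; first exact: tau0_gt0.
have := sc_le_norm (sg * tau i); rewrite norm_sgM gtr0_norm//.
have := stepE i; rewrite /step; lra.
Qed.

Lemma center_neq0 i : sg * tau i != 0.
Proof. by rewrite -normr_gt0 norm_sgM normr_gt0 gt_eqF// tau_gt0. Qed.

Lemma step_gt0 i : 0 < step i.
Proof. by rewrite stepE divr_gt0// sc_gt0// center_neq0. Qed.

Lemma tau_noninc i j : (i <= j)%N -> tau j <= tau i.
Proof.
move=> /subnK <-; elim: (j - i)%N => // n IH; rewrite addSn (le_trans _ IH)//.
by have := step_gt0 (n + i); rewrite /step subr_gt0 => /ltW.
Qed.

(** Near a positive infimum T the steps would stay above a fixed multiple of sc (sg * T), and the
    sequence would cross T. *)
Lemma tau_small e : 0 < e -> exists N, forall i, (N <= i)%N -> tau i < e.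
Proof.
move=> e0; suff [N HN] : exists N, tau N < e.
  by exists N => i Ni; exact: le_lt_trans (tau_noninc Ni) HN.
apply: contrapT => nH.
have He i : e <= tau i by rewrite leNgt; apply/negP => ?; apply: nH; exists i.
pose T := inf (range tau).
have hT : has_inf (range tau).
  by split; [exists (tau 0%N), 0%N|exists e => _ [i _ <-]].
have eT : e <= T by apply: (lb_le_inf hT.1) => _ [i _ <-].
have sT : 0 < sc (sg * T).
  by rewrite sc_gt0// -normr_gt0 norm_sgM normr_gt0 gt_eqF// (lt_le_trans e0).
have [_ [i _ <-] iT] : exists2 x, range tau x & x < T + sc (sg * T) / 10.
  by apply: inf_adherent hT; rewrite divr_gt0.
have Ti j : T <= tau j by apply: (ge_inf hT.2); exists j.
have := stepE i; rewrite /step; have := Ti i.+1; have := Ti i.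
have := sc_lip (sg * T) (sg * tau i); rewrite -mulrBr norm_sgM distrC => h h1.
by rewrite ger0_norm ?subr_ge0// in h; lra.
Qed.

(** [bump i] lives where tau i.+2 <= sg * x <= tau i, hence the shift to the middle breakpoint. *)
Definition center i := sg * tau i.+1.
Definition radius i := sc (center i).

Lemma radius_gt0 i : 0 < radius i.
Proof. by rewrite sc_gt0// center_neq0. Qed.

Lemma radiusE i : radius i = 5 * step i.+1.
Proof. by rewrite stepE /radius /center; field. Qed.

Lemma step_radius i : step i <= radius i / 4 /\ radius i <= 6 * step i.
Proof.
have E : sc (sg * tau i) = 5 * step i by rewrite stepE; field.
have Ed : `|sg * tau i - center i| = step i.
  by rewrite /center -mulrBr norm_sgM ger0_norm// -/(step i) ltW// step_gt0.
have := sc_lip (sg * tau i) (center i); have := sc_lip (center i) (sg * tau i).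
by rewrite distrC Ed E -/(radius i); lra.
Qed.

(** Radii are five times the steps, which telescope; this is the summable majorant of the correction
    series. *)
Lemma sum_radius n : \sum_(0 <= i < n) radius i <= 5 * tau0.
Proof.
have -> : \sum_(0 <= i < n) radius i = 5 * (tau 1 - tau n.+1).
  elim: n => [|n IH]; first by rewrite big_geq// subrr mulr0.
  by rewrite big_nat_recr//= IH radiusE /step; ring.
have := tau_gt0 n.+1; have := tau_noninc (leq0n 1); rewrite /tau/=; lra.
Qed.

Lemma radius_le_tau i : radius i <= tau0.
Proof.
apply: (le_trans (sc_le_norm _)); rewrite /center norm_sgM gtr0_norm ?tau_gt0//.
exact: (tau_noninc (leq0n i.+1)).
Qed.

Lemma near_center_rho i x : `|x - center i| <= radius i / 4 -> `|x| <= rho.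
Proof.
move=> xc; have := radius_le_tau i; have := ler_distD 0 x (center i).
have := ler_normD (x - center i) (center i); rewrite subrK.
rewrite {2}/center norm_sgM (gtr0_norm (tau_gt0 i.+1)).
have := tau_noninc (leq0n i.+1); rewrite -[tau 0]/tau0.
have := tau0_rho; have := tau0_gt0; lra.
Qed.

Lemma center_rho i : `|center i| <= rho.
Proof. by apply: (@near_center_rho i); rewrite subrr normr0 divr_ge0// ltW// radius_gt0. Qed.

Definition chi i (x : R) := th (- (sg / step i) * x + tau i / step i).

Lemma smooth_chi i : smooth (chi i).
Proof. exact: smooth_affine. Qed.

Lemma chi_arg i x : - (sg / step i) * x + tau i / step i = (tau i - sg * x) / step i.
Proof. by field; rewrite gt_eqF// step_gt0. Qed.

Lemma chi0 i x : tau i <= sg * x -> chi i x = 0.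
Proof.
move=> h; rewrite /chi chi_arg th0// mulr_le0_ge0 ?subr_le0// invr_ge0 ltW//.
exact: step_gt0.
Qed.

Lemma chi1 i x : sg * x <= tau i.+1 -> chi i x = 1.
Proof.
move=> h; rewrite /chi chi_arg th1// ler_pdivlMr ?step_gt0// mul1r /step.
by rewrite lerD2l lerN2.
Qed.

Lemma chi_bounds k : exists2 B, 0 <= B &
  forall i j x, (j <= k)%N -> `|derive1n j (chi i) x| <= B * (step i)^-1 ^+ j.
Proof.
have [|j|B B0 HB] := @exists_bound_upto R (fun j C => forall x, `|derive1n j th x| <= C) _ _ k.+1.
- by move=> j C C' CC' H x; rewrite (le_trans (H x)).
- exact: th_bounded.
exists B => // i j x jk.
rewrite /chi derive1n_affine// normrM normrX normrN normrM mulrC.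
have -> : `|sg| = 1 by case: sg_or => ->; rewrite ?normrN normr1.
rewrite mul1r normfV (gtr0_norm (step_gt0 i)) ler_wpM2r ?HB//.
by rewrite exprn_ge0// invr_ge0 ltW// step_gt0.
Qed.

Definition bump i : R -> R := chi i - chi i.+1.

Lemma smooth_bump i : smooth (bump i).
Proof. by apply: smoothB; exact: smooth_chi. Qed.

Lemma bump_out i x : radius i / 4 < `|x - center i| -> bump i x = 0.
Proof.
have -> : `|x - center i| = `|sg * x - tau i.+1|.
  by rewrite -[in RHS](norm_sgM (_ - _)) mulrBr sgK.
have [h1 _] := step_radius i; have h2 := radiusE i.
have h3 := step_gt0 i.+1; rewrite -[bump i x]/(chi i x - chi i.+1 x).
move: h1 h2 h3; rewrite /step => h1 h2 h3.
have [h|h] := leP 0 (sg * x - tau i.+1).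
  rewrite ger0_norm// => h4.
  have h5 : tau i <= sg * x by lra.
  have h6 : tau i.+1 <= sg * x by lra.
  by rewrite (chi0 h5) (chi0 h6) subrr.
rewrite ltr0_norm// => h4.
have h5 : sg * x <= tau i.+1 by lra.
have h6 : sg * x <= tau i.+2 by lra.
by rewrite (chi1 h5) (chi1 h6) subrr.
Qed.

Lemma bump_bounds k : exists2 B, 0 <= B &
  forall i j x, (j <= k)%N -> `|derive1n j (bump i) x| <= B * (radius i)^-1 ^+ j.
Proof.
have [B B0 HB] := chi_bounds k; exists (2 * B * 6 ^+ k).
  by rewrite !mulr_ge0// exprn_ge0.
move=> i j x jk; rewrite derive1nB; [|exact: smooth_chi..].
have r0 := radius_gt0 i.
have H w : 0 < w -> radius i <= 6 * w -> B * w^-1 ^+ j <= B * 6 ^+ k * (radius i)^-1 ^+ j.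
  move=> w0 rw; rewrite -mulrA ler_wpM2l//.
  apply: (@le_trans _ _ (6 ^+ j * (radius i)^-1 ^+ j)).
    rewrite -exprMn; apply: lerXn2r; rewrite ?nnegrE ?mulr_ge0 ?invr_ge0 ?(ltW w0) ?(ltW r0)//.
    by rewrite ler_pdivlMr// mulrC ler_pdivrMr.
  by rewrite ler_wpM2r ?exprn_ge0 ?invr_ge0 ?(ltW r0)//; apply: ler_weXn2l => //; lra.
apply: (le_trans (ler_normB _ _)).
apply: (le_trans (lerD (HB i j x jk) (HB i.+1 j x jk))).
have h1 := H _ (step_gt0 i) (step_radius i).2.
have h2 : B * (step i.+1)^-1 ^+ j <= B * 6 ^+ k * (radius i)^-1 ^+ j.
  by apply: H; rewrite ?step_gt0// radiusE; have := step_gt0 i.+1; lra.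
by apply: (le_trans (lerD h1 h2)); rewrite le_eqVlt; apply/orP; left; apply/eqP; ring.
Qed.

(** The scale tends to 0 along the pieces, so good nodes of every order are available from some
    piece on. *)
Lemma side_nodes : exists bs : nat -> seq R, (forall i, anchored K sc (center i) (bs i)) /\
  forall m, exists N, forall i, (N <= i)%N ->
    exists2 n, (m <= n)%N & good_nodes K sc n (center i) (bs i).
Proof.
apply: (@diagonal_choice _ (fun i => anchored K sc (center i))
  (fun n i => good_nodes K sc n (center i))).
- by move=> i; apply: anchored_ex; exact: center_neq0.
- by move=> n i b [].
- move=> n; have [s0 s00 H] := good_ex n; have [N HN] := tau_small s00.
  exists N => i Ni; apply: H; rewrite radius_gt0/=.
  apply: (le_trans (sc_le_norm _)); rewrite norm_sgM gtr0_norm ?tau_gt0//.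
  by apply/ltW/HN; rewrite (leq_trans Ni).
Qed.

Definition bounded_derivs (F : R -> R) m (M : R) :=
  forall j x, (j <= m)%N -> `|x| <= rho -> `|derive1n j F x| <= M.

(** * The one-sided operator for a fixed choice of nodes *)

Section operator.
Variable bs : nat -> seq R.
Hypothesis bs_anchored : forall i, anchored K sc (center i) (bs i).
Hypothesis bs_good : forall m, exists N, forall i, (N <= i)%N ->
  exists2 n, (m <= n)%N & good_nodes K sc n (center i) (bs i).

(* [bump i] is a partition of unity near [0] on the side [sg * x > 0]; replacing [F] by its
   interpolant on each piece removes the dependence on the values of [F] off [K]. *)
Definition corr (F : R -> R) i : R -> R := bump i * (horner (interp (bs i) F) - F).

Lemma smooth_defect F i : smooth F -> smooth (horner (interp (bs i) F) - F).
Proof. by move=> sF; apply: smoothB => //; exact: smooth_horner. Qed.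

Lemma smooth_corr F i : smooth F -> smooth (corr F i).
Proof. by move=> sF; apply: smoothM; [exact: smooth_bump|exact: smooth_defect]. Qed.

(** Off the ball the product vanishes on an open set; inside, [derive1nM_le] applies with r = 1 /
    radius i. *)
Lemma bumpM_le k (B A : R) (G : R -> R) i : smooth G -> 0 <= A ->
    (forall j x, (j <= k)%N -> `|derive1n j (bump i) x| <= B * (radius i)^-1 ^+ j) ->
    (forall j x, (j <= k)%N -> `|x - center i| <= radius i / 4 ->
      `|derive1n j G x| <= A * (radius i)^-1 ^+ j) ->
  forall x, `|derive1n k (bump i * G) x| <= 2 ^+ k * B * A * (radius i)^-1 ^+ k.
Proof.
move=> sG A0 HB HA x; have r0 := radius_gt0 i.
have B0 : 0 <= B.
  by have := le_trans (normr_ge0 _) (HB 0%N x isT); rewrite expr0 mulr1.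
have [xc|xc] := leP `|x - center i| (radius i / 4); last first.
  rewrite (@derive1n_near0 _ _ _ [set x | radius i / 4 < `|x - center i|])//.
  - by rewrite normr0 !mulr_ge0 ?exprn_ge0// invr_ge0 ltW.
  - rewrite (_ : [set x | _] = (fun x => `|x - center i|) @^-1` [set y | radius i / 4 < y])//.
    apply: open_comp; last exact: open_gt.
    move=> y _; apply: (@continuous_comp _ _ _ (fun y => y - center i) Num.norm).
      by apply: cvgB; [exact: cvg_id|exact: cvg_cst].
    exact: norm_continuous.
  - by move=> y /bump_out hy; rewrite fctE hy mul0r.
apply: derive1nM_le => //; first by rewrite invr_ge0 ltW.
- exact: smooth_bump.
- by move=> j jk; exact: HB.
- by move=> j jk; exact: HA.
Qed.

(** With m = k + 3 the j-th derivative of the defect is O(s^(k + 1 - j)); after multiplication by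
    the bump, order k leaves one factor s. *)
Lemma corr_le_large k : exists2 C, 0 <= C & exists N, forall i, (N <= i)%N ->
  forall F M, smooth F -> bounded_derivs F k.+3 M ->
  forall x, `|derive1n k (corr F i) x| <= C * M * radius i.
Proof.
have [B B0 HB] := bump_bounds k; have [N HN] := bs_good k.+3.
exists (2 ^+ k * B * (k`!%:R + 1)); first by rewrite !mulr_ge0// ?exprn_ge0// addr_ge0.
exists N => i /HN[n kn [[ub bK _] nb s1 [A A1 [bA lag]]]] F M sF FM x.
have r0 := radius_gt0 i.
have M0 : 0 <= M := le_trans (normr_ge0 _) (FM 0%N _ isT (center_rho i)).
have err := @interp_error _ (bs i) F (center i) (radius i) rho A M k.+3 ub sF
  (leq_trans kn nb) (center_rho i) r0 s1 A1 bA
  (fun y yb => K_rho (bK y yb)) lag (FM k.+3 ^~ (leqnn _)).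
have k1 : 0 <= (k`!%:R + 1 : R) by rewrite addr_ge0.
have H := @bumpM_le k B (M * (k`!%:R + 1) * radius i ^+ k.+1) _ i (@smooth_defect F i sF)
  _ (HB i) _ x.
apply: (le_trans (H _ _)).
- by rewrite !mulr_ge0// exprn_ge0// ltW.
- move=> j y jk yc.
  apply: (le_trans (err j y (leq_trans jk _) yc (near_center_rho yc))).
    by rewrite !leqW.
  rewrite -[leLHS]mulrA.
  have -> : radius i ^+ k.+3 / radius i ^+ j.+2 = radius i ^+ k.+1 * (radius i)^-1 ^+ j.
    by rewrite !exprS exprVn; field; rewrite ?expf_neq0 ?(gt_eqF r0).
  rewrite !mulrA ler_wpM2r ?exprn_ge0 ?invr_ge0 ?(ltW r0)//.
  rewrite ler_wpM2r ?exprn_ge0 ?(ltW r0)// ler_wpM2l// lerD2r ler_nat.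
  exact: leq_fact.
rewrite le_eqVlt; apply/orP; left; apply/eqP; rewrite exprS exprVn; field.
by rewrite ?expf_neq0 ?(gt_eqF r0).
Qed.

(** For a single piece the constant may depend on [i], so crude bounds of the basis polynomials on
    the ball of radius [rho] suffice; (1 + radius i)^k brings them to the form that [bumpM_le]
    expects. *)
Lemma corr_le_small k i : exists C, forall F M, smooth F -> bounded_derivs F k.+3 M ->
  forall x, `|derive1n k (corr F i) x| <= C * M * radius i.
Proof.
have [B B0 HB] := bump_bounds k; have r0 := radius_gt0 i.
have [_ bK _] := bs_anchored i.
have [j C C' CC' H x xr| j |La La0 HLa] := @exists_bound_upto R (fun j C => forall x, `|x| <= rho ->
    \sum_(y <- bs i) `|(lagr (bs i) y)^`(j).[x]| <= C) _ _ k.+1.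
- exact: le_trans (H x xr) CC'.
- elim: {1}(bs i) => [|y b [C HC]]; first by exists 0 => x _; rewrite big_nil.
  have [C' HC'] := smooth_bounded_on j rho (@smooth_horner _ (lagr (bs i) y)).
  exists (C' + C) => x xr; rewrite big_cons lerD ?HC//.
  by have := HC' x xr; rewrite derive1n_horner.
exists (2 ^+ k * B * ((La + 1) * (1 + radius i) ^+ k) * (radius i)^-1 ^+ k / radius i).
move=> F M sF FM x.
have M0 : 0 <= M := le_trans (normr_ge0 _) (FM 0%N _ isT (center_rho i)).
have H := @bumpM_le k B (M * (La + 1) * (1 + radius i) ^+ k) _ i (@smooth_defect F i sF)
  _ (HB i) _ x.
have r1 : 1 <= 1 + radius i by rewrite lerDl ltW.
apply: (le_trans (H _ _)).
- by rewrite !mulr_ge0 ?addr_ge0// exprn_ge0// (le_trans _ r1).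
- move=> j y jk yc; have yr := near_center_rho yc.
  apply: (@le_trans _ _ (M * (La + 1))).
    rewrite derive1nB//; last exact: smooth_horner.
    rewrite (le_trans (ler_normB _ _))// mulrDr mulr1 lerD//; last first.
      by apply: FM => //; rewrite (leq_trans jk)// !leqW.
    rewrite derive1n_horner /interp raddf_sum/= horner_sum (le_trans (ler_norm_sum _ _ _))//.
    apply: (@le_trans _ _ (\sum_(z <- bs i) M * `|(lagr (bs i) z)^`(j).[y]|)).
      rewrite !big_seq; apply: ler_sum => z zb.
      rewrite derivnZ hornerZ normrM ler_wpM2r//.
      by have := FM 0%N z isT (K_rho (bK z zb)); rewrite derive1n0.
    by rewrite -mulr_sumr ler_wpM2l// HLa.
  rewrite -mulrA ler_peMr ?mulr_ge0 ?addr_ge0//.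
  rewrite exprVn ler_pdivlMr ?exprn_gt0// mul1r.
  apply: (@le_trans _ _ ((1 + radius i) ^+ j)).
    by apply: lerXn2r; rewrite ?nnegrE ?(ltW r0)// ?lerDr// (le_trans _ r1).
  exact: ler_weXn2l.
by rewrite le_eqVlt; apply/orP; left; apply/eqP; field; rewrite ?expf_neq0 ?(gt_eqF r0).
Qed.

Lemma corr_le k : exists2 C, 0 <= C & forall F M, smooth F -> bounded_derivs F k.+3 M ->
  forall i x, `|derive1n k (corr F i) x| <= C * M * radius i.
Proof.
have [C1 C10 [N HN]] := corr_le_large k.
have [|j|C2 C20 HC2] := @exists_bound_upto R (fun i C => forall F M, smooth F ->
  bounded_derivs F k.+3 M -> forall x, `|derive1n k (corr F i) x| <= C * M * radius i) _ _ N.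
- move=> i C C' CC' H F M sF FM x; apply: (le_trans (H F M sF FM x)).
  have M0 : 0 <= M := le_trans (normr_ge0 _) (FM 0%N _ isT (center_rho i)).
  by rewrite ler_wpM2r ?(ltW (radius_gt0 i))// ler_wpM2r.
- exact: corr_le_small.
exists (Num.max C1 C2); first by rewrite le_max C10.
move=> F M sF FM i x.
have M0 : 0 <= M := le_trans (normr_ge0 _) (FM 0%N _ isT (center_rho i)).
have [Ni|iN] := leqP N i.
  apply: (le_trans (HN i Ni F M sF FM x)).
  by rewrite !ler_wpM2r ?(ltW (radius_gt0 i))// le_max lexx.
apply: (le_trans (HC2 i iN F M sF FM x)).
by rewrite !ler_wpM2r ?(ltW (radius_gt0 i))// le_max lexx orbT.
Qed.

Lemma bounded_derivs_exist F m : smooth F -> exists2 M, 0 <= M & bounded_derivs F m M.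
Proof.
move=> sF.
have [|j|M M0 HM] := @exists_bound_upto R
  (fun j C => forall x, `|x| <= rho -> `|derive1n j F x| <= C) _ _ m.+1.
- by move=> j C C' CC' H x xr; exact: le_trans (H x xr) CC'.
- exact: smooth_bounded_on.
- by exists M => // j x jm; exact: HM.
Qed.

Lemma dominated_corr F : smooth F -> dominated radius (corr F).
Proof.
move=> sF; split=> [i|k]; first exact: smooth_corr.
have [C C0 HC] := corr_le k; have [M M0 FM] := bounded_derivs_exist k.+3 sF.
by exists (C * M); [exact: mulr_ge0|move=> i x; exact: HC].
Qed.

Let radius_ge0 i : 0 <= radius i := ltW (radius_gt0 i).

(** Where sg * x > 0 the bumps sum to [chi 0], so this is the sum of the interpolants weighted by
    the bumps; writing it as a correction of F makes the terms of the series small near 0. *)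
Definition side_ext (F : R -> R) : R -> R := chi 0 * F + fun_series (corr F).

Lemma side_extE F x : side_ext F x = chi 0 x * F x + fun_series (corr F) x.
Proof. by []. Qed.

Lemma corrE F i x :
  corr F i x = (chi i x - chi i.+1 x) * ((interp (bs i) F).[x] - F x).
Proof. by []. Qed.

Lemma smooth_side_ext F : smooth F -> smooth (side_ext F).
Proof.
move=> sF; apply: smoothD; first by apply: smoothM => //; exact: smooth_chi.
exact: (smooth_fun_series radius_ge0 sum_radius (dominated_corr sF)).
Qed.

Lemma corr_lin (c : R) F G i x :
  corr (c *: F + G) i x = c * corr F i x + corr G i x.
Proof.
rewrite /corr interp_lin !fctE hornerD hornerZ /GRing.scale/=; ring.
Qed.

Lemma side_ext_lin (c : R) F G : smooth F -> smooth G ->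
  side_ext (c *: F + G) = c *: side_ext F + side_ext G.
Proof.
move=> sF sG; apply/funext => x.
have cF := @is_cvg_fun_series _ _ _ radius_ge0 sum_radius _ x (dominated_corr sF).
have cG := @is_cvg_fun_series _ _ _ radius_ge0 sum_radius _ x (dominated_corr sG).
have E : fun_series (corr (c *: F + G)) x =
    c * fun_series (corr F) x + fun_series (corr G) x.
  rewrite /fun_series (_ : (_ ^~ x) = c *: (corr F ^~ x) + (corr G ^~ x)); last first.
    by apply/funext => i; rewrite corr_lin.
  by rewrite lim_seriesD//; [rewrite lim_seriesZ|exact: is_cvg_seriesZ].
rewrite side_extE E.
rewrite -[RHS]/(c * side_ext F x + side_ext G x) !side_extE.
rewrite -[(c *: F + G) x]/(c * F x + G x); ring.
Qed.

(** The ball must contain [x] for the term [chi 0 * F], and have radius at least [rho] for the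
    corrections. *)
Lemma side_ext_le k (r : R) : exists2 C, 0 <= C & forall F M, smooth F -> 0 <= M ->
  (forall j x, (j <= k.+3)%N -> `|x| <= Num.max r rho -> `|derive1n j F x| <= M) ->
  forall x, `|x| <= r -> `|derive1n k (side_ext F) x| <= C * M.
Proof.
have [C C0 HC] := corr_le k; have [B B0 HB] := chi_bounds k.
have w0 := step_gt0 0.
pose D := B * (1 + (step 0)^-1) ^+ k.
have w1 : 1 <= 1 + (step 0)^-1 by rewrite lerDl invr_ge0 ltW.
have D0 : 0 <= D by rewrite mulr_ge0// exprn_ge0// (le_trans _ w1).
exists (2 ^+ k * D + C * (5 * tau0)).
  by apply: addr_ge0; apply: mulr_ge0 => //; rewrite mulr_ge0// ltW.
move=> F M sF M0 FM x xr.
have bF : bounded_derivs F k.+3 M.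
  by move=> j y jk yr; apply: FM => //; rewrite le_max yr orbT.
have dF := dominated_corr sF.
rewrite derive1nD; last 2 first.
- by apply: smoothM => //; exact: smooth_chi.
- exact: (smooth_fun_series radius_ge0 sum_radius dF).
apply: (le_trans (ler_normD _ _)); rewrite mulrDl lerD//.
  have := @derive1nM_le _ k (chi 0) F x D M 1 ler01 (@smooth_chi 0) sF.
  rewrite expr1n mulr1; apply=> j jk; rewrite expr1n mulr1; last first.
    by apply: FM; rewrite ?le_max ?xr// (leq_trans jk)// !leqW.
  apply: (le_trans (HB 0%N j x jk)); rewrite ler_wpM2l//.
  apply: (@le_trans _ _ ((1 + (step 0)^-1) ^+ j)); last exact: ler_weXn2l.
  by apply: lerXn2r; rewrite ?nnegrE ?invr_ge0 ?(ltW w0)// ?lerDr// (le_trans _ w1).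
rewrite [leRHS]mulrAC.
apply: (derive1n_fun_series_le radius_ge0 sum_radius x dF); first exact: mulr_ge0.
by move=> i y; exact: HC.
Qed.

Lemma fun_series0 (u : nat -> R -> R) x : (forall i, u i x = 0) -> fun_series u x = 0.
Proof.
move=> u0; rewrite /fun_series (_ : u ^~ x = fun=> 0); last by apply/funext.
rewrite (_ : series _ = cst 0); first exact: lim_cst.
by apply/funext => n; rewrite /series/= big1.
Qed.

Lemma side_ext_opposite F x : sg * x <= 0 -> side_ext F x = F x.
Proof.
move=> sx; have sxt i : sg * x <= tau i by rewrite (le_trans sx)// ltW// tau_gt0.
rewrite side_extE fun_series0; last first.
  by move=> i; rewrite corrE !chi1// subrr mul0r.
by rewrite addr0 chi1// mul1r.
Qed.

(** Here [chi 0] is 1 by [K_tau], and each correction vanishes: [x] is outside the bump or, by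
    [anchored], a node. *)
Lemma side_ext_node F x : K x -> side_ext F x = F x.
Proof.
move=> Kx; rewrite side_extE fun_series0; last first.
  move=> i; rewrite -[LHS]/(bump i x * ((interp (bs i) F).[x] - F x)).
  have [xc|/bump_out -> //] := leP `|x - center i| (radius i / 4); last by rewrite mul0r.
  have [ub bK ba] := bs_anchored i.
  by rewrite interp_node ?ba// subrr mulr0.
by rewrite addr0 chi1 ?mul1r// K_tau.
Qed.

(** All interpolants are 0, so the corrections telescope to - F * chi 0, as [chi n x] is eventually
    0. *)
Lemma side_ext_vanish F x : (forall y, K y -> F y = 0) -> 0 < sg * x -> side_ext F x = 0.
Proof.
move=> F0 sx; have I0 i : interp (bs i) F = 0.
  have [_ bK _] := bs_anchored i.
  by rewrite /interp big_seq big1// => y yb; rewrite F0 ?scale0r//; exact: bK.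
have E n : series (corr F ^~ x) n = - F x * (chi 0 x - chi n x).
  elim: n => [|n IH]; first by rewrite /series/= big_geq// subrr mulr0.
  by rewrite seriesSr IH corrE I0 horner0; ring.
have [N HN] := tau_small sx.
rewrite side_extE.
have -> : fun_series (corr F) x = - F x * chi 0 x.
  apply: cvg_lim => //; apply: cvg_near_cst; exists N => // n Nn.
  by rewrite /= E (chi0 (ltW (HN n Nn))) subr0.
ring.
Qed.

End operator.

Theorem side_operator : exists V : {linear Cinfty R -> Cinfty R},
  [/\ continuous V, (forall (F : Cinfty R) x, sg * x <= 0 -> V F x = F x),
      (forall (F : Cinfty R) x, K x -> V F x = F x) &
      forall (F : Cinfty R), (forall y, K y -> F y = 0) -> forall x, 0 < sg * x -> V F x = 0].
Proof.
have [bs [ba bg]] := side_nodes.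
have sV (F : Cinfty R) : side_ext bs F \in @smooth_pred R.
  by rewrite inE; apply: smooth_side_ext => //; exact: Cinfty_smoothP.
pose V0 (F : Cinfty R) := MkCinfty (sV F).
have lin : linear V0.
  move=> c F G; apply: val_inj.
  have E1 : Cinfty_fun (c *: F + G) = c *: (F : R -> R) + G.
    by rewrite -[LHS]/(val (c *: F + G)) linearP.
  have E2 : Cinfty_fun (c *: V0 F + V0 G) = c *: (V0 F : R -> R) + V0 G.
    by rewrite -[LHS]/(val (c *: V0 F + V0 G)) linearP.
  rewrite -[RHS]/(Cinfty_fun (c *: V0 F + V0 G)) E2.
  rewrite -[LHS]/(side_ext bs (c *: F + G : Cinfty R)) E1.
  by apply: side_ext_lin => //; exact: Cinfty_smoothP.
pose B := GRing.isLinear.Build R (Cinfty R) (Cinfty R) *:%R V0 lin.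
pose V : {linear Cinfty R -> Cinfty R} := HB.pack V0 B.
exists V; split.
- apply: continuous_Cinfty => k r; have [C C0 HC] := side_ext_le ba bg k r.
  exists C, k.+3, (Num.max r rho); split=> // F M M0 FM x xr.
  by apply: HC => //; exact: Cinfty_smoothP.
- by move=> F x; exact: side_ext_opposite.
- by move=> F x; exact: side_ext_node.
- by move=> F F0 x; exact: side_ext_vanish.
Qed.

End side.

(** * Combination of the two sides *)

Unset Implicit Arguments.

Theorem proposition3p3 (R : realType) (a : R^nat)
  (a_gt0 : forall l, 0 < a l)
  (a_decr : nonincreasing_seq a)
  (a_convex : convex_seq a)
  (a_null : a @ \oo --> (0 : R))
  (a_bounded : forall p : R, 1 < p ->
     bounded_fun (fun l : nat => a l `^ p / a l.+1)) :
  smooth_extension_property ([set 0] `|` range a).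
Proof.
have [th [th_smooth th0 th1 th_bounded]] := smooth_step R.
(* The scale at tau0 is at most gap a 0, so a 0 <= tau0 - scale a tau0 / 5, as [K_tau] requires on
   the right. *)
pose tau0 := a 0%N + gap a 0.
have gap00 : 0 <= gap a 0 := gap_ge0 a_decr 0.
have tau0_gt0 : 0 < tau0 by rewrite ltr_wpDr.
have sc_le := scale_le_norm a_gt0 a_null.
have aj j : 0 < a j <= a 0%N by rewrite a_gt0 a_decr.
have K_rho y : ([set 0] `|` range a) y -> `|y| <= 2 * tau0.
  case=> [->|[j _ <-]]; first by rewrite normr0; lra.
  by have /andP[h1 h2] := aj j; rewrite gtr0_norm// /tau0; lra.
have side sg : sg = 1 \/ sg = -1 -> exists V : {linear Cinfty R -> Cinfty R},
    [/\ continuous V, (forall (F : Cinfty R) x, sg * x <= 0 -> V F x = F x),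
        (forall (F : Cinfty R) x, ([set 0] `|` range a) x -> V F x = F x) &
        forall F : Cinfty R, (forall y, ([set 0] `|` range a) y -> F y = 0) ->
          forall x, 0 < sg * x -> V F x = 0].
  move=> sg_or; apply: (@side_operator _ _ (scale a) sg tau0 (2 * tau0) th) => //.
  - exact: scale_lip.
  - exact: scale_gt0.
  - have n0 : `|sg * tau0| = tau0.
      by case: sg_or => ->; rewrite ?mul1r ?mulN1r ?normrN gtr0_norm.
    have := sc_le (sg * tau0); rewrite n0 => s0.
    move=> y [->|[j _ <-]]; first by rewrite mulr0; lra.
    have /andP[h1 h2] := aj j; case: sg_or s0 => ->; rewrite ?mul1r ?mulN1r => s0; last by lra.
    have := scale_le a tau0 0%N; rewrite {1}/tau0 addrAC subrr add0r ger0_norm// maxxx.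
    by rewrite /tau0 in s0 *; lra.
  - exact: anchored_exists.
  - exact: good_nodes_exist.
have [Vp [Vp_cont Vp_opp Vp_node Vp_vanish]] := side 1 (or_introl erefl).
have [Vm [Vm_cont Vm_opp Vm_node Vm_vanish]] := side (-1) (or_intror erefl).
(* [Vp] removes the dependence on values off [K] on the right; [Vm] then does so on the left and
   keeps what [Vp] produced on the right. *)
apply: (@smooth_extension_of_operator _ _ (Vm \o Vp)).
- by move=> F; apply: continuous_comp; [exact: Vp_cont|exact: Vm_cont].
- move=> F F0.
  have VpK y : ([set 0] `|` range a) y -> Vp F y = 0 by move=> Ky; rewrite Vp_node// F0.
  apply: val_inj; apply/funext => x; rewrite -[LHS]/(Vm (Vp F) x) -[RHS]/((0 : R -> R) x).
  have [x0|x0|->] := ltgtP x 0.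
  + by rewrite Vm_vanish// mulN1r oppr_gt0.
  + by rewrite Vm_opp ?mulN1r ?oppr_le0 ?(ltW x0)// Vp_vanish// mul1r.
  + by rewrite Vm_node ?VpK//; left.
- by move=> F x Kx; rewrite -[LHS]/(Vm (Vp F) x) Vm_node// Vp_node.
Qed.
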